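(* Fix $t\in\mathbb{N}$ with $t\ge2$. The underlying treewidth of the class of $K_t$-minor-free graphs equals $t-2$. Moreover, there is a constant $C_t$ such that every $K_t$-minor-free graph $G$ of treewidth $k\ge2$ satisfies $\mathrm{tpw}_{t-2}(G)\le C_t\,k^2\log k$.
   Context: Graphs are finite, simple and undirected; $\mathrm{tw}$ denotes treewidth. For graphs $G,H$, an $H$-partition of $G$ is a partition $(V_x : x\in V(H))$ of $V(G)$ such that for every edge $vw$ of $G$ with $v\in V_x$, $w\in V_y$, either $x=y$ or $xy\in E(H)$; its width is $\max_x|V_x|$. $\mathrm{tpw}_c(G)$ is the minimum width of an $H$-partition of $G$ over all graphs $H$ with $\mathrm{tw}(H)\le c$. The underlying treewidth of a graph class $\mathcal{G}$ is the minimum $c\in\mathbb{N}_0$ for which there is a function $f$ with $\mathrm{tpw}_c(G)\le f(\mathrm{tw}(G))$ for all $G\in\mathcal{G}$ (unbounded if no such $c$ exists). *)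

(* Defs.v *)
From mathcomp Require Import all_boot.
From Stdlib Require Import Reals.

Set Implicit Arguments.
Unset Strict Implicit.
Unset Printing Implicit Defensive.

Record graph := Graph {
  vert :> finType;
  adj : rel vert;
  adj_sym : symmetric adj;
  adj_irr : irreflexive adj
}.

Definition connected_in (G : graph) (S : {set G}) : Prop :=
  forall u v, u \in S -> v \in S ->
    connect [rel x y | [&& adj x y, x \in S & y \in S]] u v.

(* A tree: nonempty, connected, with exactly |V|-1 edges (edges counted as
   ordered pairs, hence the factor 2). *)
Definition is_tree (T : graph) : Prop :=
  0 < #|T| /\ connected_in [set: T] /\
  #|[set p : T * T | adj p.1 p.2]| = 2 * (#|T| - 1).

Definition tree_decomposition (G : graph) (T : graph) (B : T -> {set G}) : Prop :=
  is_tree T /\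
  (forall v : G, exists x : T, v \in B x) /\
  (forall v w : G, adj v w -> exists x : T, (v \in B x) && (w \in B x)) /\
  (forall v : G, connected_in [set x : T | v \in B x]).

Definition tw_le (G : graph) (k : nat) : Prop :=
  exists (T : graph) (B : T -> {set G}),
    tree_decomposition B /\ forall x : T, #|B x| <= k.+1.

Definition has_tw (G : graph) (k : nat) : Prop :=
  tw_le G k /\ forall j, tw_le G j -> k <= j.

(* H-partition of G given by p : V(G) -> V(H) (part V_x = p^{-1}(x), parts may be
   empty); its width is max_x |V_x|.  tpw_le c G w  <->  tpw_c(G) <= w. *)
Definition is_H_partition (G H : graph) (p : G -> H) : Prop :=
  forall v w : G, adj v w -> p v = p w \/ adj (p v) (p w).

Definition tpw_le (c : nat) (G : graph) (w : nat) : Prop :=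
  exists (H : graph) (p : G -> H),
    tw_le H c /\ is_H_partition p /\ forall x : H, #|[set v | p v == x]| <= w.

Definition graph_class := graph -> Prop.

Definition tpw_bounded_by_tw (C : graph_class) (c : nat) : Prop :=
  exists f : nat -> nat, forall G : graph, C G ->
    forall k, has_tw G k -> tpw_le c G (f k).

Definition underlying_tw_eq (C : graph_class) (c : nat) : Prop :=
  tpw_bounded_by_tw C c /\ forall c', tpw_bounded_by_tw C c' -> c <= c'.

Definition is_minor (H G : graph) : Prop :=
  exists phi : H -> {set G},
    (forall x, phi x != set0) /\
    (forall x y, x != y -> [disjoint phi x & phi y]) /\
    (forall x, connected_in (phi x)) /\
    (forall x y, adj x y -> exists u v, [/\ u \in phi x, v \in phi y & adj u v]).

Lemma complete_sym (t : nat) : symmetric (fun i j : 'I_t => i != j).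
Proof. by move=> i j; rewrite eq_sym. Qed.

Lemma complete_irr (t : nat) : irreflexive (fun i j : 'I_t => i != j).
Proof. by move=> i; rewrite eqxx. Qed.

Definition K (t : nat) : graph := @Graph 'I_t _ (@complete_sym t) (@complete_irr t).

Definition Kt_minor_free (t : nat) : graph_class := fun G => ~ is_minor (K t) G.

(* Main.v *)
(** Upper bound, with c = t - 2. Parts are placed one at a time so that every
    connected set X of unplaced vertices sees at most c parts, which are pairwise
    adjacent, and only O(k) vertices of each. If X sees fewer than c parts, a single
    vertex of X is the next part. Otherwise the next part must meet every connected
    set Y in X that sees all c parts. By the Erdos-Posa property of connected sets
    in a graph of treewidth k it suffices to bound the number of disjoint sets Y,
    and K_t-minor-freeness bounds it linearly in the O(k) attachment vertices:
    contracting the sets Y into these vertices creates a dense minor (Mader), unless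
    some set is attached to a clique and gives a K_t minor. Closing the hitting set
    of bags under least common ancestors costs a factor 2 and keeps the number of
    vertices seen in the new part O(k). The parts have size O(k^2).

    Lower bound: in the d-fold iterated cone over l disjoint copies, a partition into
    parts of size at most l has d + 1 pairwise adjacent parts, because some copy
    avoids the part of the apex. *)

Require Import Defs.
From Stdlib Require Import Reals Lra Classical ClassicalEpsilon.
From mathcomp Require Import all_boot zify.

Set Implicit Arguments.
Unset Strict Implicit.
Unset Printing Implicit Defensive.

(** * Connected sets *)

Section Connectivity.
Variable G : graph.
Implicit Types (A B S X Y : {set G}) (u v x y : G).

Definition touch A B := [exists x in A, exists y in B, adj x y].

Lemma touchP A B :
  reflect (exists x y, [/\ x \in A, y \in B & adj x y]) (touch A B).
Proof.
apply: (iffP exists_inP) => [[x xA /exists_inP[y yB xy]]|[x [y [xA yB xy]]]].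
  by exists x, y.
by exists x => //; apply/exists_inP; exists y.
Qed.

Lemma touch_sym A B : touch A B = touch B A.
Proof.
by apply/touchP/touchP => -[x [y [xA yB xy]]]; exists y, x; rewrite adj_sym.
Qed.

Lemma touchS A B A' B' :
  A \subset A' -> B \subset B' -> touch A B -> touch A' B'.
Proof.
move=> /subsetP sA /subsetP sB /touchP[x [y [xA yB xy]]].
by apply/touchP; exists x, y; split; [exact: sA|exact: sB|].
Qed.

Lemma touchUl A B S : touch (A :|: B) S = touch A S || touch B S.
Proof.
apply/idP/orP => [/touchP[x [y [/setUP[xA|xB] yS xy]]]|[]].
- by left; apply/touchP; exists x, y.
- by right; apply/touchP; exists x, y.
- by apply: touchS; rewrite ?subsetUl.
- by apply: touchS; rewrite ?subsetUr.
Qed.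

Lemma touch1l x A : touch [set x] A = [exists y in A, adj x y].
Proof.
apply/touchP/exists_inP => [[a [b [/set1P -> bA xb]]]|[y yA xy]].
  by exists b.
by exists x, y; rewrite set11.
Qed.

Lemma connected_cut S A u v : connected_in S ->
  u \in S -> u \in A -> v \in S -> v \notin A ->
  exists x y, [/\ x \in S, x \in A, y \in S, y \notin A & adj x y].
Proof.
move=> cS uS uA vS vA.
have /connectP[p pP lp] := cS u v uS vS.
elim: p u uS uA pP lp => [|z p IH] u uS uA /=.
  by move=> _ vu; rewrite vu uA in vA.
case/andP => /and3P[uz _ zS] pP lp.
case zA: (z \in A); first exact: (IH z).
by exists u, z; rewrite zA.
Qed.

(** Converse of [connected_cut]: an edge would have to leave the set of vertices reachable from
    [u]. *)
Lemma connected_from S u : u \in S ->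
  (forall A, u \in A -> (exists2 v, v \in S & v \notin A) ->
    exists x y, [/\ x \in S, x \in A, y \in S, y \notin A & adj x y]) ->
  connected_in S.
Proof.
move=> uS cut.
pose e := [rel x y : G | [&& adj x y, x \in S & y \in S]].
have se : symmetric e by move=> x y /=; rewrite adj_sym [(x \in S) && _]andbC.
have H v : v \in S -> connect e u v.
  move=> vS; apply/negPn/negP => nuv.
  have [||x [y [xS xA yS yA xy]]] := cut [set z | connect e u z].
  - by rewrite inE connect0.
  - by exists v; rewrite ?inE.
  move: xA yA; rewrite !inE => ux /negP[]; apply: connect_trans ux _.
  by apply: connect1; rewrite /= xy xS.
move=> a b aS bS; apply: (@connect_trans _ e u); last exact: H.
by rewrite (sym_connect_sym se) H.
Qed.

Lemma connected1 u : connected_in [set u].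
Proof. by move=> a b /set1P -> /set1P ->; exact: connect0. Qed.

Lemma connectedU A B : connected_in A -> connected_in B ->
  touch A B || (A :&: B != set0) -> connected_in (A :|: B).
Proof.
move=> cA cB tAB.
have [->|/set0Pn[u uA]] := eqVneq A set0; first by rewrite set0U.
apply: (@connected_from _ u) => [|D uD [v vAB vD]]; first by rewrite inE uA.
have [AD|/subsetPn[a aA aD]] := boolP (A \subset D); last first.
  have [x [y [xS xD yS yD xy]]] := connected_cut cA uA uD aA aD.
  by exists x, y; rewrite !inE xS yS.
have vB : v \in B.
  by case/setUP: vAB => // vA; rewrite (subsetP AD) in vD.
have [BD|/pred0Pn[b /= /andP[bB bD]]] := boolP [disjoint B & D].
  case/orP: tAB => [/touchP[x [y [xA yB xy]]]|/set0Pn[x /setIP[xA xB]]].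
    exists x, y; rewrite !inE xA yB orbT (subsetP AD) //; split=> //.
    by rewrite (disjointFr BD).
  by have := disjointFr BD xB; rewrite (subsetP AD).
have [x [y [xS xD yS yD xy]]] := connected_cut cB bB bD vB vD.
by exists x, y; rewrite !inE xS yS !orbT.
Qed.

(** A connected set that touches or meets [X] without lying in it can be added to [X], and
    [#|U| - #|X|] drops. *)
Lemma component_exists (U : {set G}) v : v \in U ->
  exists X, [/\ v \in X, X \subset U, connected_in X &
    forall Y, connected_in Y -> Y \subset U -> touch X Y || (X :&: Y != set0) ->
      Y \subset X].
Proof.
move=> vU.
pose P X := (v \in X) && (X \subset U).
have : exists X, P X /\ connected_in X.
  by exists [set v]; rewrite /P set11 sub1set; split=> //; exact: connected1.
case=> X [PX cX].
have [n] := ubnP (#|U| - #|X|); elim: n X PX cX => // n IH X /andP[vX XU] cX le.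
have [[Y [cY YU XY nYX]]|no] := classic (exists Y, [/\ connected_in Y, Y \subset U,
   touch X Y || (X :&: Y != set0) & ~~ (Y \subset X)]); last first.
  exists X; split=> // Y cY YU XY; apply/negPn/negP => nYX; apply: no.
  by exists Y.
have XYU : X :|: Y \subset U by rewrite subUset XU.
apply: (IH (X :|: Y)); [by rewrite /P inE vX|exact: connectedU|].
have : X \proper X :|: Y by rewrite properE subsetUl subUset subxx.
move=> /proper_card; move: (subset_leq_card XYU) le; lia.
Qed.

End Connectivity.

(** * Elimination schemes *)

(* A vertex elimination scheme of width k: [B v] is the set of neighbours of [v]
   that precede [v] in a chordal completion, and [rk] orders the vertices (it
   may identify non-adjacent ones). *)
Record elim_scheme (G : graph) (k : nat) (rk : G -> nat) (B : G -> {set G}) :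
    Prop := ElimScheme {
  elim_rk : forall u v, u \in B v -> rk u < rk v;
  elim_adj : forall u v, adj u v -> u \in B v \/ v \in B u;
  elim_chordal : forall u w v, u \in B v -> w \in B v ->
    [\/ u = w, u \in B w | w \in B u];
  elim_width : forall v, #|B v| <= k }.

Section Elimination.
Variables (G : graph) (k : nat) (rk : G -> nat) (B : G -> {set G}).
Hypothesis elimB : elim_scheme k rk B.
Implicit Types (X Y Z W : {set G}) (u v w x y z m : G).

(** Chordality makes this the ancestor order of a rooted forest, with ranks increasing away from the
    roots. *)
Definition anc z y := connect [rel a b | b \in B a] y z.

Lemma anc_refl z : anc z z. Proof. exact: connect0. Qed.

Lemma anc_trans z y x : anc z y -> anc y x -> anc z x.
Proof. by move=> zy yx; apply: connect_trans yx zy. Qed.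

Lemma anc1 z y : z \in B y -> anc z y.
Proof. exact: (@connect1 _ [rel a b | b \in B a]). Qed.

Lemma ancP z y : reflect (z = y \/ exists2 x, x \in B y & anc z x) (anc z y).
Proof.
apply: (iffP idP) => [/connectP[[|x p] /= pP ->]|[->|[x xy zx]]].
- by left.
- by case/andP: pP => xy pP; right; exists x => //; apply/connectP; exists p.
- exact: anc_refl.
- exact: anc_trans zx (anc1 xy).
Qed.

Lemma anc_ind (P : G -> Prop) z :
  P z -> (forall x y, x \in B y -> anc z x -> P x -> P y) ->
  forall y, anc z y -> P y.
Proof.
move=> Pz PS y; have [n] := ubnP (rk y); elim: n y => // n IH y le /ancP[<-//|].
case=> x xy zx; apply: (PS x) => //; apply: IH => //.
by have := elim_rk elimB xy; lia.
Qed.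

Lemma anc_rk z y : anc z y -> rk z <= rk y.
Proof.
elim/anc_ind => [|x {}y xy _ le] //; apply: leq_trans le (ltnW (elim_rk elimB xy)).
Qed.

Lemma anc_eq z y : anc z y -> rk y <= rk z -> z = y.
Proof.
case/ancP => // -[x xy zx]; have := elim_rk elimB xy; have := anc_rk zx; lia.
Qed.

(** Climb from [y] to [w]: at each step [u] and the next vertex share a set [B], and chordality
    passes the lower-ranked [u] on. *)
Lemma bag_anc w y u : anc w y -> u \in B y -> rk u < rk w -> u \in B w.
Proof.
elim/anc_ind => // x {}y xy wx IH uy lt; apply: IH => //.
have := anc_rk wx.
by case: (elim_chordal elimB uy xy) => [e|//|/(elim_rk elimB)]; first rewrite e in lt; lia.
Qed.

(** The first steps up from [y] lead into [B y], whose members chordality makes comparable. *)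
Lemma anc_comparable x x' y : anc x y -> anc x' y -> anc x x' \/ anc x' x.
Proof.
have [n] := ubnP (rk y); elim: n y => // n IH y le xy x'y.
case/ancP: (xy) => [->|[a ay xa]]; first by right.
case/ancP: (x'y) => [->|[b yb x'b]]; first by left.
have := elim_rk elimB ay; have := elim_rk elimB yb => rb ra.
case: (elim_chordal elimB ay yb) => [ab|ab|ba].
- by apply: (IH a) => //; [lia|rewrite ab].
- by apply: (IH b) => //; [lia|exact: anc_trans xa (anc1 ab)].
- by apply: (IH a) => //; [lia|exact: anc_trans x'b (anc1 ba)].
Qed.

(** Adjacent vertices are comparable, so an edge leaving the descendants of [z] goes up past [z],
    and [bag_anc] applies. *)
Lemma below_exit z y x : anc z y -> adj y x -> ~~ anc z x -> x \in B z.
Proof.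
move=> zy yx nzx; case: (elim_adj elimB yx) => [yBx|xBy].
  by case/negP: nzx; apply: anc_trans zy (anc1 yBx).
have [lt|le] := ltnP (rk x) (rk z); first exact: bag_anc xBy lt.
case: (anc_comparable zy (anc1 xBy)) => [zx|xz]; first by rewrite zx in nzx.
by rewrite (anc_eq xz le) anc_refl in nzx.
Qed.

Lemma connected_exit Y z y x : connected_in Y -> y \in Y -> anc z y ->
  x \in Y -> ~~ anc z x -> Y :&: B z != set0.
Proof.
move=> cY yY zy xY nzx.
have [||a [b []]] := connected_cut (A := [set a | anc z a]) cY yY _ xY.
- by rewrite inE.
- by rewrite inE.
rewrite !inE => aY za bY nzb ab; apply/set0Pn; exists b.
by rewrite inE bY (below_exit za ab).
Qed.

Definition is_top m Y := m \in Y /\ forall y, y \in Y -> anc m y.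

(** A vertex [m] of least rank works: if some vertex were not below it, [Y] would meet [B m], where
    ranks are smaller. *)
Lemma top_exists Y : connected_in Y -> Y != set0 -> exists m, is_top m Y.
Proof.
move=> cY /set0Pn[y0 y0Y]; case: (arg_minnP rk y0Y) => m mY min.
exists m; split=> // y yY; apply/negPn/negP => nmy.
have /set0Pn[x /setIP[xY xm]] := connected_exit cY mY (anc_refl m) yY nmy.
by have := elim_rk elimB xm; have := min _ xY; lia.
Qed.

Definition bag z := z |: B z.

Lemma card_bag z : #|bag z| <= k.+1.
Proof.
by rewrite cardsU1; have := elim_width elimB z; case: (_ \notin _); lia.
Qed.

Definition bags Z := \bigcup_(z in Z) bag z.

Lemma card_bags Z : #|bags Z| <= #|Z| * k.+1.
Proof.
rewrite -sum_nat_const /bags -!big_enum /=.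
elim/big_ind2: _ => [|a A b C hA hC|z _]; [by rewrite cards0| |exact: card_bag].
by apply: leq_trans (leq_card_setU _ _) _; lia.
Qed.

Lemma bagsP Z v : reflect (exists2 z, z \in Z & v \in bag z) (v \in bags Z).
Proof. exact: bigcupP. Qed.

Lemma meets_bags Z Z' Y : Z \subset Z' -> Y :&: bags Z != set0 ->
  Y :&: bags Z' != set0.
Proof.
move=> /subsetP ZZ' /set0Pn[y /setIP[yY /bagsP[z zZ yz]]].
by apply/set0Pn; exists y; rewrite inE yY; apply/bagsP; exists z; [exact: ZZ'|].
Qed.

(* Pick a good set whose top is as low as possible: every good set that meets
   it also meets the bag of its top. *)
Lemma erdos_posa N (good : {set G} -> Prop) :
  (forall Y, good Y -> connected_in Y /\ Y != set0) ->
  (exists F : {set {set G}}, [/\ trivIset F, #|F| = N.+1 &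
     forall Y, Y \in F -> good Y]) \/
  (exists Z, #|Z| <= N /\ forall Y, good Y -> Y :&: bags Z != set0).
Proof.
elim: N good => [|N IH] good gP.
  have [[Y gY]|no] := classic (exists Y, good Y); [left|right].
    exists [set Y]; split; [|by rewrite cards1|by move=> _ /set1P->].
    by apply/trivIsetP => A C /set1P-> /set1P->; rewrite eqxx.
  by exists set0; rewrite cards0; split=> // Y gY; case: no; exists Y.
have [[Y0 gY0]|no] := classic (exists Y, good Y); last first.
  by right; exists set0; rewrite cards0; split=> // Y gY; case: no; exists Y.
have [Y [m [gY tY max]]] : exists Y m, [/\ good Y, is_top m Y &
    forall Y' m', good Y' -> is_top m' Y' -> rk m' <= rk m].
  apply: NNPP => no.
  (* Without a maximum there would be tops of arbitrarily large rank. *)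
  have step n : exists Y m, [/\ good Y, is_top m Y & n <= rk m].
    elim: n => [|n [Y [m [gY tY le]]]].
      by have [cY nY] := gP _ gY0; have [m mP] := top_exists cY nY; exists Y0, m.
    apply: NNPP => no'; apply: no; exists Y, m; split=> // Y' m' gY' tY'.
    by rewrite leqNgt; apply/negP => lt; apply: no'; exists Y', m'; split=> //; lia.
  have [Y [m [_ _]]] := step (\max_(v : G) rk v).+1.
  by rewrite ltnNge leq_bigmax.
have hit Y' : good Y' -> Y' :&: Y != set0 -> Y' :&: bag m != set0.
  move=> gY' /set0Pn[y /setIP[yY' yY]]; have [cY' nY'] := gP _ gY'.
  have [m' tY'] := top_exists cY' nY'.
  have [mm'|nmm'] := boolP (anc m m').
    have mm : m = m' by apply: anc_eq mm' _; exact: max tY'.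
    by apply/set0Pn; exists m; rewrite !inE eqxx mm (proj1 tY').
  have /set0Pn[x /setIP[xY xm]] := connected_exit cY' yY' (proj2 tY _ yY) (proj1 tY') nmm'.
  by apply/set0Pn; exists x; rewrite !inE xY xm orbT.
(* Induct on the good sets that miss the bag of [m]: by [hit] they are disjoint from [Y]. The other
   good sets are hit at [m]. *)
have [|[F [tF cF gF]]|[Z [cZ hZ]]] := IH (fun Y' => good Y' /\ Y' :&: bag m = set0).
- by move=> Y' [/gP].
- left; exists (Y |: F).
  have dY Y' : Y' \in F -> [disjoint Y & Y'].
    move=> /gF[gY' e]; rewrite -setI_eq0 setIC; apply/negPn/negP => /(hit _ gY').
    by rewrite e eqxx.
  have F0 : set0 \notin F.
    by apply/negP => /gF[/gP[_]]; rewrite eqxx.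
  have [tYF YF] := trivIsetU1 dY tF F0.
  by split; rewrite ?cardsU1 ?YF ?cF // => Y' /setU1P[->|/gF[]].
- right; exists (m |: Z); split; first by rewrite cardsU1; case: (_ \notin _); lia.
  move=> Y' gY'; have [e|ne] := eqVneq (Y' :&: bag m) set0.
    by apply: (@meets_bags Z); [exact: subsetUr|exact: hZ].
  apply: (@meets_bags [set m]); first exact: subsetUl.
  by rewrite /bags big_set1.
Qed.

(** Closure under least common ancestors without naming them: the elements of [Z] below any [m] have
    a topmost one. *)
Definition lca_closed Z := forall m z, z \in Z -> anc m z ->
  exists z0, [/\ z0 \in Z, anc m z0 & forall z', z' \in Z -> anc m z' -> anc z0 z'].

(** Vertices are added one at a time. Each [w] brings at most one more, its lowest ancestor [x] that
    lies above an element already present. *)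
Lemma lca_closure W : exists Z, [/\ W \subset Z, #|Z| <= 2 * #|W| & lca_closed Z].
Proof.
have [n] := ubnP #|W|; elim: n W => // n IH W le.
have [->|/set0Pn[w wW]] := eqVneq W set0.
  by exists set0; rewrite sub0set cards0; split=> // m z; rewrite inE.
have cW := cardsD1 w W; rewrite wW in cW.
have [|Z [WZ cZ closZ]] := IH (W :\ w); first lia.
have WZ' : W \subset w |: Z by rewrite -(setD1K wW) setUS.
have [wZ|wZ] := boolP [exists x, anc x w && [exists z in Z, anc x z]]; last first.
  exists (w |: Z); split=> //; first by rewrite cardsU1; case: (_ \notin _); lia.
  move=> m z zZ mz; have [mw|mw] := boolP (anc m w).
    have no z' : z' \in Z -> ~~ anc m z'.
      move=> z'Z; apply/negP => mz'; case/negP: wZ; apply/existsP; exists m.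
      by rewrite mw; apply/exists_inP; exists z'.
    exists w; rewrite setU11; split=> // z' /setU1P[->|z'Z]; first by rewrite anc_refl.
    by rewrite (negPf (no _ z'Z)).
  have {}zZ : z \in Z by case/setU1P: zZ => // e; rewrite -e mz in mw.
  have [z0 [z0Z mz0 low]] := closZ _ _ zZ mz.
  exists z0; rewrite setU1r //; split=> // z' /setU1P[->|]; last exact: low.
  by rewrite (negPf mw).
case/existsP: wZ => x0 x0P.
case: (@arg_maxnP _ x0 [pred x | anc x w && [exists z in Z, anc x z]] rk x0P) => {x0 x0P} x /=.
case/andP => xw /exists_inP[z1 z1Z xz1] max.
exists (w |: (x |: Z)); split; first by apply: subset_trans WZ' (setUS _ (subsetUr _ _)).
  by rewrite !cardsU1; case: (w \notin _); case: (x \notin _); lia.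
(* If [m] is not above [w], nothing changes. If it is above [w] but above no element of [Z], then
   [w] is topmost. Otherwise [m] is above [x], and the higher of [x] and the old topmost element is
   topmost. *)
move=> m z zZ mz; have [mw|mw] := boolP (anc m w); last first.
  have mx : ~~ anc m x by apply: contra mw => mx; apply: anc_trans mx xw.
  have {}zZ : z \in Z.
    by case/setU1P: zZ => [e|/setU1P[e|//]]; rewrite -e mz in mw mx.
  have [z0 [z0Z mz0 low]] := closZ _ _ zZ mz.
  exists z0; rewrite !(setU1r, z0Z) //; split=> // z' /setU1P[->|/setU1P[->|]].
  - by rewrite (negPf mw).
  - by rewrite (negPf mx).
  - exact: low.
have [z2Z|noZ] := boolP [exists z in Z, anc m z]; last first.
  have mx : ~~ anc m x.
    apply: contra noZ => mx; apply/exists_inP; exists z1 => //.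
    exact: anc_trans mx xz1.
  exists w; rewrite setU11; split=> // z' /setU1P[->|/setU1P[->|z'Z]].
  - by rewrite anc_refl.
  - by rewrite (negPf mx).
  - by move=> mz'; case/negP: noZ; apply/exists_inP; exists z'.
have mx : anc m x.
  have lex : rk m <= rk x by apply: max; rewrite mw z2Z.
  case: (anc_comparable mw xw) => // xm.
  by rewrite (anc_eq xm lex) anc_refl.
case/exists_inP: z2Z => z2 z2Z mz2.
have [z0 [z0Z mz0 low]] := closZ _ _ z2Z mz2.
have z0z1 := low _ z1Z (anc_trans mx xz1).
case: (anc_comparable z0z1 xz1) => [z0x|xz0].
  exists z0; rewrite !(setU1r, z0Z) //; split=> // z' /setU1P[->|/setU1P[->|]] //.
  - by move=> _; exact: anc_trans z0x xw.
  - exact: low.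
exists x; rewrite setU1r ?setU11 //; split=> // z' /setU1P[->|/setU1P[->|]] //.
  by move=> _; exact: anc_refl.
by move=> z'Z mz'; apply: anc_trans xz0 (low _ z'Z mz').
Qed.

(** Let [m] be the top of [Y]. Neighbours outside [B m] lie below [m]. As [Y] avoids the bags, it
    cannot pass beneath the topmost element [z0] of [Z] below [m], so these neighbours lie in the
    bag of [z0]. This gives k + (k + 1). *)
Lemma few_bag_neighbours Z Y : lca_closed Z -> connected_in Y -> Y != set0 ->
  [disjoint Y & bags Z] ->
  #|[set q in bags Z | [exists y in Y, adj y q]]| <= k.*2.+1.
Proof.
move=> closZ cY nY dY; have [m [mY tY]] := top_exists cY nY.
have mZ : m \notin bags Z by rewrite (disjointFr dY).
have low q y : q \in bags Z -> y \in Y -> adj y q -> q \in B m \/ anc m q.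
  move=> qZ yY yq; have [mq|mq] := boolP (anc m q); first by right.
  by left; exact: below_exit (tY _ yY) yq mq.
have [[z zZ mz]|no] := classic (exists2 z, z \in Z & anc m z); last first.
  apply: (@leq_trans #|B m|); last by have := elim_width elimB m; lia.
  apply/subset_leq_card/subsetP => q; rewrite inE => /andP[qZ /exists_inP[y yY yq]].
  case: (low _ _ qZ yY yq) => // mq; case: no.
  case/bagsP: qZ => z zZ /setU1P[e|qz]; first by exists z => //; rewrite -e.
  exists z => //; exact: anc_trans mq (anc1 qz).
have [z0 [z0Z mz0 lowz0]] := closZ _ _ zZ mz.
have z0m : ~~ anc z0 m.
  apply/negP => z0m; have := anc_eq z0m (anc_rk mz0) => e.
  by case/negP: mZ; rewrite -e; apply/bagsP; exists z0 => //; rewrite setU11.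
apply: (@leq_trans #|B m :|: bag z0|); last first.
  apply: leq_trans (leq_card_setU _ _) _.
  by have := elim_width elimB m; have := card_bag z0; lia.
apply/subset_leq_card/subsetP => q; rewrite inE => /andP[qZ /exists_inP[y yY yq]].
case: (low _ _ qZ yY yq) => [qm|mq]; first by rewrite inE qm.
rewrite inE; apply/orP; right.
case/bagsP: (qZ) => z' z'Z qz'.
have qz'a : anc q z' by case/setU1P: qz' => [->|/anc1 //]; exact: anc_refl.
have z0z' := lowz0 _ z'Z (anc_trans mq qz'a).
have nz0y : ~~ anc z0 y.
  apply/negP => z0y; have /set0Pn[x /setIP[xY xz0]] := connected_exit cY yY z0y mY z0m.
  have := disjointFr dY xY => /bagsP[]; exists z0 => //.
  by rewrite inE xz0 orbT.
have nz0q : anc z0 q -> q = z0.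
  move=> z0q; rewrite adj_sym in yq; have yz0 := below_exit z0q yq nz0y.
  have := disjointFr dY yY => /bagsP[]; exists z0 => //.
  by rewrite inE yz0 orbT.
case: (anc_comparable z0z' qz'a) => [/nz0q ->|qz0]; first exact: setU11.
have [e|ne] := eqVneq q z0; first by rewrite e setU11.
case/setU1P: qz' => [e|qz']; first by case/eqP: ne; apply: nz0q; rewrite e.
rewrite inE (bag_anc z0z' qz') ?orbT //.
rewrite ltnNge; apply/negP => /(anc_eq qz0)/eqP; by rewrite (negPf ne).
Qed.

End Elimination.

(** * Elimination schemes and treewidth *)

Section RootedTree.
Variables (T : graph) (tT : is_tree T).

Lemma rooted_tree : exists (r : T) (par : T -> T) (d : T -> nat),
  (forall x, x != r -> d (par x) < d x) /\
  (forall x y, adj x y -> (x != r /\ y = par x) \/ (y != r /\ x = par y)).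
Proof.
case: tT => /card_gt0P[r _] [cT eT]; exists r.
(* [N n] is the ball of radius [n] around the root; a tree with [#|T| - 1] edges
   has no other edges than those of this breadth-first search. *)
pose N n := iter n (fun A : {set T} => A :|: [set y | [exists x in A, adj x y]]) [set r].
have NS n y : y \in N n.+1 = (y \in N n) || [exists x in N n, adj x y].
  by rewrite /N iterS inE inE.
have ex x : exists n, x \in N n.
  have gen (p : seq T) : forall a m, a \in N m ->
      path [rel u v | [&& adj u v, u \in [set: T] & v \in [set: T]]] a p ->
      exists n, last a p \in N n.
    elim: p => [|y p IH] a m aN /=; first by exists m.
    case/andP => /andP[ay _]; apply: (IH y m.+1).
    by rewrite NS; apply/orP; right; apply/existsP; exists a; rewrite aN.
  have /connectP[p pP ->] := cT r x (in_setT _) (in_setT _).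
  by apply: gen pP; apply: (_ : r \in N 0); rewrite inE.
pose d x := ex_minn (ex x).
have dN x : x \in N (d x) by rewrite /d; case: ex_minnP.
have dmin x n : x \in N n -> d x <= n by rewrite /d; case: ex_minnP => m _ H /H.
(* The default is returned only at the root, where [d] vanishes. *)
pose par x := odflt x [pick z | adj z x & d z < d x].
have parP x : x != r -> adj (par x) x && (d (par x) < d x).
  move=> xr; rewrite /par; case: pickP => //= no.
  have := dN x; case e: (d x) => [|n]; first by rewrite inE (negPf xr).
  rewrite NS => /orP[/dmin|/exists_inP[z zN zx]]; first by rewrite e ltnn.
  by have := no z; rewrite zx e ltnS dmin.
exists par, d; split=> [x /parP/andP[]//|].
pose A1 := [set (x, par x) | x in [set~ r]].
pose A2 := [set (par x, x) | x in [set~ r]].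
have c1 : #|A1| = #|T| - 1.
  by rewrite card_imset ?cardsC1 ?subn1 // => x y [].
have c2 : #|A2| = #|T| - 1.
  by rewrite card_imset ?cardsC1 ?subn1 // => x y [].
have d12 : [disjoint A1 & A2].
  apply/pred0P => -[a b] /=; apply/negP => /andP[/imsetP[x xr [-> ->]]].
  case/imsetP => y yr [e1 e2]; move: xr yr; rewrite !inE => /parP/andP[_ l1].
  by move=> /parP/andP[_]; rewrite -e1 -e2 ltnNge (ltnW l1).
have E12 : A1 :|: A2 = [set p : T * T | adj p.1 p.2].
  apply/eqP; rewrite eqEcard eT cardsU disjoint_setI0 // cards0 c1 c2.
  apply/andP; split; last lia.
  apply/subsetP => p /setUP[]/imsetP[x]; rewrite !inE => /parP/andP[a _] -> //=.
  by rewrite adj_sym.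
move=> x y xy; have : (x, y) \in A1 :|: A2 by rewrite E12 inE.
by case/setUP => /imsetP[z]; rewrite !inE => zr [-> ->]; [left|right].
Qed.

End RootedTree.

(** Root the tree and let [tau v] be the node nearest the root whose bag holds [v]. Order the
    vertices by the depth of [tau] and keep, for [v], the earlier members of the bag at [tau v].
    Leaving out [v] itself turns k + 1 into k. *)
Lemma tw_le_elim (G : graph) k : tw_le G k -> exists rk B, @elim_scheme G k rk B.
Proof.
case=> T [B [[tT [cov [edge conn]]] width]].
have [r [par [d [dpar adjT]]]] := rooted_tree tT.
have tauP v : exists x, v \in B x /\ forall y, v \in B y -> d x <= d y.
  have [x0 x0v] := cov v.
  by case: (@arg_minnP _ x0 [pred x | v \in B x] d x0v) => x xv min; exists x.
pose tau v := proj1_sig (constructive_indefinite_description _ (tauP v)).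
have tauB v : v \in B (tau v) by rewrite /tau; case: constructive_indefinite_description => x [].
have tau_min v y : v \in B y -> d (tau v) <= d y.
  by rewrite /tau; case: constructive_indefinite_description => x [] /= _; exact.
pose desc x y := connect [rel a b | (a != r) && (b == par a)] y x.
(* Among the nodes holding [v], a path from [x] to [tau v] leaves the descendants of [x], which is
   possible only through the parent of [x]. *)
have up v x : v \in B x -> x != tau v -> x != r /\ v \in B (par x).
  move=> vx xt.
  have desc_d a : desc x a -> a != x -> d x < d a.
    case/connectP => p; elim: p a => [|b p IH] a /=; first by move=> _ ->; rewrite eqxx.
    case/andP => /andP[ar /eqP->] pP lp _.
    have [e|ne] := eqVneq (par a) x; first by rewrite -e; exact: dpar.
    exact: ltn_trans (IH _ pP lp ne) (dpar _ ar).
  have ndt : ~~ desc x (tau v).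
    apply/negP => /desc_d; rewrite eq_sym xt => /(_ isT).
    by rewrite ltnNge tau_min.
  have descxx : desc x x by exact: connect0.
  have [||||a [b []]] := connected_cut (A := [set a | desc x a]) (conn v)
     (u := x) (v := tau v); rewrite ?inE ?tauB ?descxx //.
  rewrite ?inE => va xa vb nxb /adjT[[ar e]|[br e]]; last first.
    case/negP: nxb; apply: connect_trans xa; apply: connect1.
    by rewrite /= br e eqxx.
  have [ax|ax] := eqVneq a x; first by rewrite -ax -e.
  case/negP: nxb; case/connectP: xa => [[|c p] /= pP lp]; first by rewrite lp eqxx in ax.
  by apply/connectP; exists p => //; case/andP: pP => /andP[_ /eqP c_]; rewrite e -c_.
(* Climb from [x] to [tau w]. The vertex [u] is not lost on the way, since [tau u] is no deeper than
   [tau w]. *)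
have key u w x : u \in B x -> w \in B x -> d (tau u) <= d (tau w) -> u \in B (tau w).
  have [n] := ubnP (d x); elim: n x => // n IH x le ux wx duw.
  have [<-//|xw] := eqVneq x (tau w).
  have [xr wp] := up _ _ wx xw.
  have lt := dpar _ xr; have dw := tau_min _ _ wp.
  have xu : x != tau u by apply: contraTneq duw => <-; lia.
  have [_ upx] := up _ _ ux xu.
  by apply: (IH (par x)) => //; lia.
(* The index breaks ties of depth, which makes [rk] injective. *)
pose rk (v : G) := d (tau v) * #|G| + enum_rank v.
have rk_inj : injective rk.
  move=> u v; have := ltn_ord (enum_rank u); have := ltn_ord (enum_rank v).
  rewrite /rk => lu lv e; apply/enum_rank_inj/val_inj => /=.
  have := congr1 (modn^~ #|G|) e.
  by rewrite /= !modnMDl !modn_small.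
have rk_d u v : rk u <= rk v -> d (tau u) <= d (tau v).
  have aux a b n i j : i < n -> j < n -> a * n + i <= b * n + j -> a <= b by nia.
  exact: aux (ltn_ord _) (ltn_ord _).
pose B' v := [set u in B (tau v) | rk u < rk v].
exists rk, B'; split.
- by move=> u v; rewrite inE => /andP[].
- move=> u v uv; have [x /andP[ux vx]] := edge _ _ uv.
  have uNv : u != v by apply: contraTneq uv => ->; rewrite adj_irr.
  have [lt|lt|/rk_inj e] := ltngtP (rk u) (rk v); last by rewrite e eqxx in uNv.
    by left; rewrite inE lt (key u v x) // rk_d // ltnW.
  by right; rewrite inE lt (key v u x) // rk_d // ltnW.
- move=> u w v; rewrite !inE => /andP[uv _] /andP[wv _].
  have [lt|lt|/rk_inj e] := ltngtP (rk u) (rk w); last exact: Or31 e.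
    by apply: Or32; rewrite andbT; exact: key uv wv (rk_d _ _ (ltnW lt)).
  by apply: Or33; rewrite andbT; exact: key wv uv (rk_d _ _ (ltnW lt)).
- move=> v; rewrite -ltnS; apply: leq_trans (width (tau v)).
  apply: proper_card; apply/properP; split; last first.
    by exists v => //; rewrite inE ltnn andbF.
  by apply/subsetP => u; rewrite inE => /andP[].
Qed.

Section ElimTree.
Variables (G : graph) (k : nat) (rk : G -> nat) (B : G -> {set G}).
Hypothesis elimB : elim_scheme k rk B.

Definition elim_parent (v : G) : option G :=
  omap (fun u0 => [arg max_(u > u0 in B v) rk u]) [pick u in B v].

(** As the parent has the largest rank in [B v], chordality puts the rest of [B v] into its own
    set. *)
Lemma elim_parentP v :
  match elim_parent v with
  | Some y => y \in B v /\ forall u, u \in B v -> u = y \/ u \in B y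
  | None => B v = set0
  end.
Proof.
rewrite /elim_parent; case: pickP => [u0 u0v|no] /=; last first.
  by apply/setP => u; rewrite no inE.
case: arg_maxnP => // y yv max; split=> // u uv.
case: (elim_chordal elimB uv yv) => [|uy|yu]; [by left|by right|].
by have := elim_rk elimB yu; have := max _ uv; lia.
Qed.

Lemma elim_parent_in v y : elim_parent v = Some y -> y \in B v.
Proof. by move=> e; have := elim_parentP v; rewrite e => -[]. Qed.

(* An extra root [None] joins the trees of the elimination forest. *)
Definition elim_tree_adj : rel (option G) := fun a b =>
  (if a is Some x then elim_parent x == b else false) ||
  (if b is Some y then elim_parent y == a else false).

Lemma elim_tree_sym : symmetric elim_tree_adj.
Proof. by move=> a b; rewrite /elim_tree_adj orbC. Qed.

Lemma elim_parent_neq v : elim_parent v != Some v.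
Proof.
apply/eqP => /elim_parent_in/(elim_rk elimB); by rewrite ltnn.
Qed.

Lemma elim_tree_irr : irreflexive elim_tree_adj.
Proof.
by case=> [v|] //; rewrite /elim_tree_adj orbb; apply/negbTE/elim_parent_neq.
Qed.

Definition elim_tree := Graph elim_tree_sym elim_tree_irr.

Lemma elim_tree_is_tree : is_tree elim_tree.
Proof.
split; [|split].
- by apply/card_gt0P; exists None.
- apply: (@connected_from _ _ (None : elim_tree)) => [|A rA [[x|] _ xA]]; first by rewrite inE.
    have [n] := ubnP (rk x); elim: n x xA => // n IH x xA le.
    case e: (elim_parent x) => [y|].
      have [yA|yA] := boolP ((Some y : elim_tree) \in A).
        exists (Some y), (Some x); rewrite !inE yA xA; split=> //.
        by rewrite /adj /= /elim_tree_adj e eqxx orbT.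
      apply: (IH y) => //.
      by have := elim_rk elimB (elim_parent_in e); lia.
    exists None, (Some x); rewrite !inE rA xA; split=> //.
    by rewrite /adj /= /elim_tree_adj e eqxx.
  by rewrite rA in xA.
(* Each vertex contributes the edge to its parent: [#|G|] edges on [#|G|.+1] nodes. *)
- pose A1 : {set elim_tree * elim_tree} := [set (Some x, elim_parent x) | x in [set: G]].
  pose A2 : {set elim_tree * elim_tree} := [set (elim_parent x, Some x) | x in [set: G]].
  have c1 : #|A1| = #|G| by rewrite card_imset ?cardsT // => x y [].
  have c2 : #|A2| = #|G| by rewrite card_imset ?cardsT // => x y [].
  have d12 : [disjoint A1 & A2].
    apply/pred0P => -[a b] /=; apply/negP => /andP[/imsetP[x _ [-> ->]]].
    case/imsetP => y _ [/esym/elim_parent_in e1 /elim_parent_in e2].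
    by have := elim_rk elimB e1; have := elim_rk elimB e2; lia.
  have -> : [set p : elim_tree * elim_tree | adj p.1 p.2] = A1 :|: A2.
    apply/setP => -[a b]; rewrite !inE /adj /= /elim_tree_adj; congr (_ || _).
      apply/idP/imsetP => [|[x _ [-> ->]]]; last by rewrite eqxx.
      by case: a => // x /eqP <-; exists x.
    apply/idP/imsetP => [|[x _ [-> ->]]]; last by rewrite eqxx.
    by case: b => // x /eqP <-; exists x.
  by rewrite cardsU disjoint_setI0 // cards0 c1 c2 card_option; lia.
Qed.

(** From any node whose bag holds [v], climbing by parents leads to [Some v], and [elim_parentP]
    keeps [v] in the bags on the way. *)
Lemma elim_tw_le : tw_le G k.
Proof.
pose bg (a : elim_tree) := if a is Some x then x |: B x else set0.
exists elim_tree, bg; split; last first.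
  case=> [x|] /=; last by rewrite cards0.
  exact: (card_bag elimB).
split; first exact: elim_tree_is_tree.
split; first by move=> v; exists (Some v); rewrite /= setU11.
split.
  move=> v w vw; case: (elim_adj elimB vw) => h.
    by exists (Some w); rewrite /= setU11 inE h orbT.
  by exists (Some v); rewrite /= setU11 inE h orbT.
move=> v; apply: (@connected_from _ _ (Some v : elim_tree)).
  by rewrite inE /= setU11.
move=> A vA [[x|]]; rewrite inE /= ?inE // => vx xA.
have [n] := ubnP (rk x); elim: n x vx xA => // n IH x vx xA le.
case/orP: vx => [/eqP e|vx]; first by rewrite -e vA in xA.
have := elim_parentP x; case e: (elim_parent x) => [y|]; last by move=> h; rewrite h inE in vx.
case=> yx /(_ _ vx) vy.
have vy' : v \in y |: B y by rewrite !inE; case: vy => [->|->]; rewrite ?eqxx ?orbT.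
have [yA|yA] := boolP ((Some y : elim_tree) \in A); last first.
  by apply: (IH y) => //; [rewrite !inE in vy'|have := elim_rk elimB yx; lia].
exists (Some y), (Some x); rewrite !inE yA xA vx orbT; split=> //.
  by rewrite !inE in vy'.
by rewrite /adj /= /elim_tree_adj e eqxx orbT.
Qed.

End ElimTree.

(** * The lower bound: iterated cones *)

(** The clique lies in the bag of its member of largest rank. *)
Lemma elim_clique (G : graph) k rk (B : G -> {set G}) (C : {set G}) :
  elim_scheme k rk B -> {in C &, forall x y, x != y -> adj x y} -> #|C| <= k.+1.
Proof.
move=> eB clC; have [->|/set0Pn[x0 x0C]] := eqVneq C set0; first by rewrite cards0.
case: (@arg_maxnP _ x0 [pred x | x \in C] rk x0C) => x /= xC max.
apply: leq_trans (subset_leq_card _) (card_bag eB x).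
apply/subsetP => y yC; rewrite !inE; have [//|yx] := eqVneq y x.
case: (elim_adj eB (clC _ _ yC xC yx)) => // xy.
by have := elim_rk eB xy; have := max _ yC; lia.
Qed.

(** Take the branch set whose top [m] has the largest rank. The k + 1 others are disjoint and all
    meet [B m], which has at most k vertices. *)
Lemma elim_minor_free (G : graph) k rk (B : G -> {set G}) :
  elim_scheme k rk B -> Kt_minor_free k.+2 G.
Proof.
move=> eB [phi [phi0 [dis [con tch]]]].
have [top topP] : exists top : K k.+2 -> G, forall i, is_top B (top i) (phi i).
  exists (fun i => proj1_sig (constructive_indefinite_description _
      (top_exists eB (con i) (phi0 i)))) => i.
  by case: constructive_indefinite_description.
case: (@arg_maxnP _ (ord0 : K k.+2) xpredT (fun i => rk (top i)) isT) => i _ max.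
pose m := top i.
have hit j : j != i -> phi j :&: B m != set0.
  move=> ji; have [jtop jlow] := topP j; have [itop ilow] := topP i.
  (* By maximality [top j] is not below [m]. If the end [u] of the edge to [phi i] is below [m],
     then [phi j] leaves the descendants of [m]; if not, [u] itself is in [B m]. *)
  have nmj : ~~ anc B m (top j).
    apply/negP => mj; have e := anc_eq eB mj (max j isT).
    by have := disjointFr (dis _ _ ji) jtop; rewrite -e itop.
  have [u [v [uj vi uv]]] := tch j i ji.
  have [mu|mu] := boolP (anc B m u).
    by have := connected_exit eB (con j) uj mu jtop nmj.
  rewrite adj_sym in uv; apply/set0Pn; exists u.
  by rewrite inE uj (below_exit eB (ilow _ vi) uv mu).
pose f j := odflt m [pick x in phi j :&: B m].
have fP j : j != i -> f j \in phi j :&: B m.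
  move=> /hit/set0Pn[x xP]; rewrite /f; case: pickP => [//|/(_ x)].
  by rewrite xP.
have finj : {in [set~ i] &, injective f}.
  move=> a b; rewrite !inE => /fP/setIP[fa _] /fP/setIP[fb _] e.
  apply/eqP/negPn/negP => ab.
  by have := disjointFr (dis _ _ ab) fa; rewrite e fb.
have : #|f @: [set~ i]| <= #|B m|.
  apply/subset_leq_card/subsetP => x /imsetP[j]; rewrite !inE => /fP/setIP[_ h] ->.
  exact: h.
rewrite card_in_imset // cardsC1 card_ord /=.
by have := elim_width eB m; lia.
Qed.

Section Cone.
Variables (l : nat) (G : graph).

Definition cone_adj : rel (option ('I_l * G)) := fun a b =>
  match a, b with
  | None, Some _ | Some _, None => true
  | Some p, Some q => (p.1 == q.1) && adj p.2 q.2
  | None, None => false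
  end.

Lemma cone_sym : symmetric cone_adj.
Proof. by case=> [[i x]|] [[j y]|] //=; rewrite eq_sym adj_sym. Qed.

Lemma cone_irr : irreflexive cone_adj.
Proof. by case=> [[i x]|] //=; rewrite adj_irr andbF. Qed.

Definition cone := Graph cone_sym cone_irr.

Definition copy (i : 'I_l) (x : G) : cone := Some (i, x).

(** The apex comes first and enters the set of every other vertex, which costs one in the width. *)
Lemma cone_elim k rk (B : G -> {set G}) : elim_scheme k rk B ->
  exists rk' B', @elim_scheme cone k.+1 rk' B'.
Proof.
move=> eB.
exists (fun a : cone => if a is Some p then (rk p.2).+1 else 0).
exists (fun a : cone => if a is Some p then None |: copy p.1 @: B p.2 else set0).
have cinj i : injective (copy i) by move=> x y [].
split.
- move=> u [[i x]|] /=; rewrite ?inE // => /orP[/eqP-> //|/imsetP[y yx ->]] /=.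
  by rewrite ltnS (elim_rk eB).
- move=> [[i x]|] [[j y]|] adj_xy /=; [|by right; rewrite !inE|by left; rewrite !inE|by []].
  move: adj_xy; rewrite /adj /= => /andP[/eqP <-] /(elim_adj eB)[h|h]; [left|right].
    by apply: setU1r; exact: (imset_f (copy i) h).
  by apply: setU1r; exact: (imset_f (copy i) h).
- move=> u w [[i x]|] /=; rewrite ?inE // => /orP[/eqP->|/imsetP[a ax ->]].
    case/orP=> [/eqP->|/imsetP[b bx ->]]; first exact: Or31.
    by apply: Or32; rewrite !inE.
  case/orP=> [/eqP->|/imsetP[b bx ->]]; first by apply: Or33; rewrite !inE.
  case: (elim_chordal eB ax bx) => [->|h|h]; first exact: Or31.
    by apply: Or32; apply: setU1r; exact: imset_f.
  by apply: Or33; apply: setU1r; exact: imset_f.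
- case=> [[i x]|]; last by rewrite cards0.
  rewrite cardsU1 (card_imset _ (cinj i)).
  by rewrite -(add1n k); apply: leq_add (leq_b1 _) (elim_width eB x).
Qed.

(* The part of the apex has fewer than l other vertices, so some copy avoids it. *)
Lemma cone_copy_avoids (H : graph) (p : cone -> H) :
  (forall x : H, #|[set v | p v == x]| <= l) ->
  exists i, forall x, p (copy i x) != p None.
Proof.
move=> le; apply: NNPP => no.
have bad i : exists x, p (copy i x) == p None.
  apply: NNPP => no'; apply: no; exists i => x; apply/negP => e; apply: no'.
  by exists x.
pose f i := copy i (xchoose (bad i)).
have finj : injective f by move=> i j [].
have := le (p None); apply/negP; rewrite -ltnNge.
(* The apex and one bad vertex from each copy would be l + 1 vertices in one part. *)
have -> : l.+1 = #|None |: f @: 'I_l|.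
  rewrite cardsU1 (card_imset _ finj) card_ord.
  by case: imsetP => [[i _]|].
apply/subset_leq_card/subsetP => v; rewrite !inE => /orP[/eqP->//|/imsetP[i _ ->]].
exact: (xchooseP (bad i)).
Qed.

End Cone.

Fixpoint iter_cone l d : graph :=
  if d is d'.+1 then cone l (iter_cone l d') else K 1.

Lemma iter_cone_elim l d : exists rk B, @elim_scheme (iter_cone l d) d rk B.
Proof.
elim: d => [|d [rk [B eB]]] /=; last exact: cone_elim eB.
exists (fun=> 0), (fun=> set0); split; rewrite ?cards0 //.
- by move=> u v; rewrite inE.
- by move=> u v; rewrite !ord1 adj_irr.
- by move=> u w v; rewrite inE.
Qed.

(** Induct inside a copy that avoids the part of the apex. The last clause, that the parts in [C]
    are nonempty, makes each of them adjacent to the part of the apex. *)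
Lemma iter_cone_partition_clique l d (H : graph) (p : iter_cone l d -> H) :
  is_H_partition p -> (forall x : H, #|[set v | p v == x]| <= l) ->
  exists C : {set H}, [/\ #|C| = d.+1, {in C &, forall x y, x != y -> adj x y} &
    forall x, x \in C -> exists v, p v = x].
Proof.
elim: d p => [|d IH] p /= pP le.
  exists [set p ord0]; rewrite cards1; split=> // [x y /set1P-> /set1P->|x /set1P->].
    by rewrite eqxx.
  by exists ord0.
have [i iP] := cone_copy_avoids le.
have [||C [cC clC imC]] := IH (fun x => p (copy i x)).
- move=> v w vw; apply: pP.
  by rewrite /adj /= eqxx.
- move=> x; apply: leq_trans (le x).
  have cinj : injective (@copy l (iter_cone l d) i) by move=> a b [].
  rewrite -(card_imset _ cinj); apply/subset_leq_card/subsetP => v.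
  by case/imsetP => a; rewrite !inE => pa ->.
have ac x : x \in C -> p None != x /\ adj (p None) x.
  move=> /imC[v <-]; have ne := iP v; rewrite eq_sym; split=> //.
  have [//|e|//] := pP None (copy i v); by rewrite e eqxx in ne.
exists (p None |: C); split.
- rewrite cardsU1 cC; case: (boolP (p None \in C)) => // /ac[].
  by rewrite eqxx.
- move=> x y /setU1P[->|xC] /setU1P[->|yC] ne; rewrite ?eqxx // in ne *.
  + by have [] := ac _ yC.
  + by rewrite adj_sym; have [] := ac _ xC.
  + exact: clC.
- by move=> x /setU1P[->|/imC[v <-]]; [exists None|exists (copy i v)].
Qed.

Lemma has_tw_exists (G : graph) k : tw_le G k -> exists2 j, has_tw G j & j <= k.
Proof.
have [n] := ubnP k; elim: n k => // n IH k lt kP.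
have [[j jP jk]|no] := classic (exists2 j, tw_le G j & j < k).
  by have [|i iP ij] := IH j _ jP; [lia|exists i => //; lia].
exists k => //; split=> // j jP; rewrite leqNgt; apply/negP => jk.
by apply: no; exists j.
Qed.

Lemma Kt_minor_free_tpw_unbounded t c :
  2 <= t -> tpw_bounded_by_tw (Kt_minor_free t) c -> t - 2 <= c.
Proof.
(* The cones have treewidth at most [d] whatever [l] is, so [l] can be chosen to be at least every
   width that [f] allows them. *)
move=> t2 [f fP]; pose d := t - 2; pose l := \max_(k < d.+1) f k.
have [rk [B eB]] := iter_cone_elim l d.
have free : Kt_minor_free t (iter_cone l d).
  have -> : t = d.+2 by rewrite /d; lia.
  exact: elim_minor_free eB.
have [k kP kd] := has_tw_exists (elim_tw_le eB).
have [H [p [/tw_le_elim[rkH [BH eH]] [pP le]]]] := fP _ free _ kP.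
have fl : f k <= l by apply: (leq_bigmax (Ordinal (kd : k < d.+1))).
have [C [cC clC _]] := iter_cone_partition_clique pP (fun x => leq_trans (le x) fl).
by have := elim_clique eH clC; rewrite cC.
Qed.

(** * Dense families of branch sets *)

Section Families.
Variable G : graph.
Implicit Types (A B C X Y Z m : {set G}) (S R F M : {set {set G}}).

Definition branch_sets S :=
  trivIset S /\ forall A, A \in S -> connected_in A /\ A != set0.

Definition pairwise_touching S := {in S &, forall A B, A != B -> touch A B}.

Lemma branch_sets_disjoint S A B : branch_sets S -> A \in S -> B \in S -> A != B ->
  [disjoint A & B].
Proof. by move=> [/trivIsetP tS _]; exact: tS. Qed.

Lemma branch_setsS R S : R \subset S -> branch_sets S -> branch_sets R.
Proof.
move=> RS [tS cS]; split; first exact: trivIsetS tS.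
by move=> A /(subsetP RS)/cS.
Qed.

Lemma branch_setsU1 A R : branch_sets R -> connected_in A -> A != set0 ->
  (forall B, B \in R -> [disjoint A & B]) -> branch_sets (A |: R) /\ A \notin R.
Proof.
move=> [tR cR] cA nA dA.
have R0 : set0 \notin R by apply/negP => /cR[_]; rewrite eqxx.
have [tAR AR] := trivIsetU1 dA tR R0; split=> //; split=> //.
by move=> B /setU1P[->|/cR].
Qed.

Lemma clique_minor t M : branch_sets M -> pairwise_touching M -> t <= #|M| ->
  is_minor (K t) G.
Proof.
move=> fM tM le; pose phi (i : K t) : {set G} := enum_val (widen_ord le i).
have phiM i : phi i \in M by exact: enum_valP.
have phi_inj x y : x != y -> phi x != phi y.
  by apply: contra => /eqP/enum_val_inj/(congr1 val)/= e; apply/eqP/val_inj.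
exists phi; split; [|split; [|split]].
- by move=> x; have [] := proj2 fM _ (phiM x).
- by move=> x y /phi_inj; apply: branch_sets_disjoint (phiM x) (phiM y).
- by move=> x; have [] := proj2 fM _ (phiM x).
- by move=> x y /phi_inj /(tM _ _ (phiM x) (phiM y))/touchP[u [v h]]; exists u, v.
Qed.

Definition nbrs S A := [set B in S | (B != A) && touch A B].

(** A degree sum: every touching pair counts twice, hence the factor 2 in [edgesU1]. *)
Definition edges S := \sum_(A in S) #|nbrs S A|.

Lemma edgesU1 A R : A \notin R -> edges (A |: R) = edges R + 2 * #|nbrs R A|.
Proof.
move=> AR; rewrite /edges big_setU1 //=.
have -> : nbrs (A |: R) A = nbrs R A.
  by apply/setP => B; rewrite !inE; case: eqP => //= ->; rewrite andbF.
have -> : #|nbrs R A| = \sum_(B in R) touch A B.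
  rewrite /nbrs -sum1dep_card big_mkcondr /=; apply: eq_bigr => B BR.
  by have -> : B != A by [apply: contraNneq AR => <-]; case: touch.
rewrite mul2n -addnn addnCA; congr (_ + _).
rewrite -big_split /=; apply: eq_bigr => B BR.
have BA : B != A by apply: contraNneq AR => <-.
have -> : nbrs (A |: R) B = nbrs R B :|: (if touch A B then [set A] else set0).
  apply/setP => C; rewrite !inE.
  have [->|CA] := eqVneq C A.
    by rewrite (negPf AR) eq_sym BA /= [touch B A]touch_sym; case: (touch A B); rewrite inE ?eqxx.
  by case: (touch A B); rewrite inE ?(negPf CA) orbF.
rewrite cardsU; case: (touch A B); rewrite ?cards1 ?cards0 ?setI0 ?cards0 ?subn0 //.
rewrite (_ : _ :&: _ = set0) ?cards0 ?subn0 //.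
by apply/setP => C; rewrite !inE; have [->|_] := eqVneq C A; rewrite ?andbF // (negPf AR).
Qed.

(* Mader: a touching pair with few common neighbours can be contracted without
   losing density; otherwise some neighbourhood is dense enough for induction. *)
Lemma dense_clique_model t S : branch_sets S -> S != set0 -> 2 ^ t * #|S| <= edges S ->
  exists M, [/\ branch_sets M, pairwise_touching M, #|M| = t &
    forall m, m \in M -> m \subset cover S /\ exists2 B, B \in S & B \subset m].
Proof.
elim: t S => [|t IHt] S fS S0 dS.
  exists set0; split; rewrite ?cards0 //; try by move=> ?; rewrite inE.
  by split=> [|A]; rewrite ?inE //; apply/trivIsetP => A B; rewrite inE.
have [n] := ubnP #|S|; elim: n S fS S0 dS => // n IHn S fS S0 dS le.
have [[A [B [AS BS AB tAB few]]]|many] := classic (exists A B,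
  [/\ A \in S, B \in S, A != B, touch A B & #|nbrs S A :&: nbrs S B| < 2 ^ t]).
- pose R := S :\ A :\ B; pose AuB := A :|: B.
  have BSA : B \in S :\ A by rewrite !inE eq_sym AB.
  have BR : B \notin R by rewrite !inE eqxx.
  have AR : A \notin B |: R by rewrite setD1K // !inE eqxx.
  have AR' : A \notin R by apply: contra AR => h; rewrite inE h orbT.
  have SE : S = A |: (B |: R) by rewrite !setD1K.
  have RS : R \subset S by rewrite /R !subDset; apply/subsetP => x; rewrite !inE => ->; rewrite !orbT.
  have [cA nA] := proj2 fS _ AS; have [cB nB] := proj2 fS _ BS.
  have [|||fS' AuBR] := @branch_setsU1 AuB R (branch_setsS RS fS).
  + by apply: connectedU => //; rewrite tAB.
  + by rewrite setU_eq0 (negPf nA).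
  + move=> C CR; have CS := subsetP RS _ CR.
    rewrite disjoints_subset subUset -!disjoints_subset.
    by rewrite !(branch_sets_disjoint fS) //; [apply: contraNneq BR => ->|apply: contraNneq AR' => ->].
  have nAR : nbrs S A :\ B = nbrs R A.
    by apply/setP => C; rewrite !inE; case: (C == A); case: (C == B); case: (C \in S).
  have nBR : nbrs S B :\ A = nbrs R B.
    by apply/setP => C; rewrite !inE; case: (C == A); case: (C == B); case: (C \in S).
  have cI : nbrs S A :&: nbrs S B = nbrs R A :&: nbrs R B.
    rewrite -nAR -nBR; apply/setP => C; rewrite !inE.
    by case: (eqVneq C A); case: (eqVneq C B); rewrite /= ?andbF.
  (* Contraction loses 2 for the pair itself and 2 for each common neighbour, in total at most
     [2 ^ t.+1], the share of the one set that disappears. *)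
  have eS : edges S = edges R + 2 * #|nbrs R A| + 2 * #|nbrs R B| + 2.
    rewrite SE edgesU1 // edgesU1 //.
    have -> : nbrs (B |: R) A = B |: nbrs R A.
      by apply/setP => C; rewrite !inE; case: (eqVneq C B) => //= ->; rewrite eq_sym AB tAB.
    have -> : #|B |: nbrs R A| = #|nbrs R A|.+1 by rewrite cardsU1 inE (negPf BR).
    by move: (edges R) #|nbrs R A| #|nbrs R B| => x y z; clear; lia.
  have eS' : edges (AuB |: R) = edges R + 2 * #|nbrs R A :|: nbrs R B|.
    rewrite edgesU1 //; congr (_ + 2 * #|pred_of_set _|).
    apply/setP => C; rewrite !inE touchUl.
    case CR: (C \in S :\ A :\ B); move: CR; rewrite !inE => CR; rewrite CR //=.
    have {}CR : C \in R by rewrite !inE.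
    have CAB : C != A :|: B by apply: contraNneq AuBR => e; rewrite /AuB -e.
    have CA : C != A by apply: contraNneq AR' => <-.
    have CB : C != B by apply: contraNneq BR => <-.
    by rewrite CAB CA CB.
  have cU := cardsU (nbrs R A) (nbrs R B); rewrite -cI in cU.
  have cUI : #|nbrs S A :&: nbrs S B| <= #|nbrs R A| by rewrite cI subset_leq_card ?subsetIl.
  have cS : #|S| = #|R|.+2 by rewrite SE !cardsU1 AR BR.
  have cS' : #|AuB |: R| = #|R|.+1 by rewrite cardsU1 AuBR.
  have [||||M [fM tM cM inM]] := IHn (AuB |: R) => //.
  + by apply/set0Pn; exists AuB; rewrite setU11.
  + move: dS; rewrite eS eS' cS cS' cU expnS mulnS; move: few cUI.
    move: (2 * 2 ^ t * #|R|.+1) (2 ^ t) (edges R) #|nbrs R A| #|nbrs R B| #|nbrs S A :&: nbrs S B|.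
    by clear => *; lia.
  + by rewrite cS' -ltnS -cS.
  exists M; split=> // m /inM[ms [C CR Cm]]; split.
    apply: subset_trans ms _; apply/subsetP => x /bigcupP[D /setU1P[->|DR] xD].
      by case/setUP: xD => xD; apply/bigcupP; [exists A|exists B].
    by apply/bigcupP; exists D; rewrite ?(subsetP RS).
  case/setU1P: CR Cm => [->|CR] Cm; last by exists C => //; exact: (subsetP RS).
  by exists A => //; apply: subset_trans Cm; rewrite subsetUl.
have [A AS nA] : exists2 A, A \in S & nbrs S A != set0.
  apply/exists_inP; apply: contraT => /exists_inPn no.
  have e0 : edges S = 0.
    by apply: big1 => A AS; have /negPn/eqP-> := no _ AS; rewrite cards0.
  by move: dS; rewrite e0 leqn0 muln_eq0 expn_eq0 /= cards_eq0 (negPf S0).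
have nS : nbrs S A \subset S by apply/subsetP => B; rewrite inE => /andP[].
(* Every neighbour of [A] has at least [2 ^ t] common neighbours with [A], so the neighbourhood is
   dense enough. The sets found there contain neighbours of [A], so [A] can be added to them. *)
have [|M [fM tM cM inM]] := IHt (nbrs S A) (branch_setsS nS fS) nA.
  rewrite mulnC -sum_nat_const; apply: leq_sum => B BA.
  rewrite leqNgt; apply/negP => lt; apply: many; exists A, B.
  move: BA; rewrite inE => /and3P[BS BA tAB]; split=> //; first by rewrite eq_sym.
  apply: leq_ltn_trans lt; apply/subset_leq_card/subsetP => C.
  by rewrite !inE => /andP[/and3P[-> -> ->] /and3P[_ -> ->]].
have [cA n0A] := proj2 fS _ AS.
have [|fM' AM] := branch_setsU1 fM cA n0A.
  move=> m /inM[ms _]; rewrite disjoint_sym disjoints_subset.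
  apply: subset_trans ms _; apply/bigcupsP => B; rewrite inE => /and3P[BS BA _].
  by rewrite -disjoints_subset (branch_sets_disjoint fS).
have tAm m : m \in M -> touch A m.
  move=> /inM[_ [B]]; rewrite inE => /and3P[_ _ tAB] Bm.
  exact: touchS tAB.
exists (A |: M); split=> //; last 1 first.
- move=> m /setU1P[->|/inM[ms [B BA Bm]]].
    by split; [exact: bigcup_sup|exists A].
  split; last by exists B => //; exact: (subsetP nS).
  apply: subset_trans ms _; apply/bigcupsP => C CA.
  by apply: bigcup_sup; exact: (subsetP nS).
- move=> B C /setU1P[->|BM] /setU1P[->|CM]; rewrite ?eqxx // => ne.
  + exact: tAm.
  + by rewrite touch_sym tAm.
  + exact: tM.
- by rewrite cardsU1 AM cM.
Qed.

End Families.

(** * Absorbing sets into branch sets *)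

Lemma disjoint_setU (T : finType) (A B C : {set T}) :
  [disjoint A :|: B & C] = [disjoint A & C] && [disjoint B & C].
Proof. by rewrite -!setI_eq0 setIUl setU_eq0. Qed.

Section IndexedFamilies.
Variables (G : graph) (I : finType).
Implicit Types (J : {set I}) (phi : I -> {set G}) (X Y Z : {set G}).
Implicit Types (F M : {set {set G}}).

(** Indexed, unlike [branch_sets], so that a branch set keeps its name while it grows. *)
Definition branch_fun J phi :=
  (forall i, i \in J -> connected_in (phi i) /\ phi i != set0) /\
  {in J &, forall i j, i != j -> [disjoint phi i & phi j]}.

Lemma branch_fun_inj J phi : branch_fun J phi -> {in J &, injective phi}.
Proof.
move=> [cJ dJ] i j iJ jJ e; apply/eqP/negPn/negP => /(dJ _ _ iJ jJ).
by rewrite e -setI_eq0 setIid; have [_ /negPf->] := cJ _ jJ.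
Qed.

Lemma branch_fun_imset J phi : branch_fun J phi -> branch_sets (phi @: J).
Proof.
move=> [cJ dJ]; split=> [|_ /imsetP[i iJ ->]]; last exact: cJ.
apply/trivIsetP => _ _ /imsetP[i iJ ->] /imsetP[j jJ ->] ne.
by apply: dJ => //; apply: contraNneq ne => ->.
Qed.

Lemma branch_funS J' J phi : J' \subset J -> branch_fun J phi -> branch_fun J' phi.
Proof.
move=> /subsetP s [cJ dJ]; split=> [i /s/cJ //|i j /s iJ /s jJ]; exact: dJ.
Qed.

Definition update phi i Y j := if j == i then Y :|: phi i else phi j.

Lemma update_sub phi i Y j : phi j \subset update phi i Y j.
Proof. by rewrite /update; case: eqP => [->|_] //; exact: subsetUr. Qed.

Lemma branch_fun_update J phi i Y : branch_fun J phi -> i \in J -> connected_in Y ->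
  touch Y (phi i) -> (forall j, j \in J -> [disjoint phi j & Y]) ->
  branch_fun J (update phi i Y).
Proof.
move=> [cJ dJ] iJ cY tY dY; rewrite /update; split=> [j jJ|a b aJ bJ ab].
  have [_|ji] := eqVneq j i; last exact: cJ.
  have [ci ni] := cJ _ iJ; split; first by apply: connectedU => //; rewrite tY.
  by rewrite setU_eq0 negb_and ni orbT.
case: (eqVneq a i) => [ai|ai]; case: (eqVneq b i) => [bi|bi].
- by rewrite ai bi eqxx in ab.
- by rewrite disjoint_setU (disjoint_sym Y) dY // dJ // eq_sym.
- by rewrite disjoint_sym disjoint_setU (disjoint_sym Y) dY // dJ // eq_sym.
- exact: dJ.
Qed.

Definition iedges J phi :=
  \sum_(i in J) #|[set j in J | (j != i) && touch (phi i) (phi j)]|.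

Lemma iedgesE J phi : branch_fun J phi -> edges (phi @: J) = iedges J phi.
Proof.
move=> fJ; have inj := branch_fun_inj fJ.
rewrite /edges big_imset //=; apply: eq_bigr => i iJ.
rewrite -(card_in_imset (f := phi)); last first.
  by move=> a b; rewrite !inE => /andP[aJ _] /andP[bJ _]; exact: inj.
congr #|pred_of_set _|; apply/setP => B; rewrite inE.
apply/andP/imsetP => [[/imsetP[j jJ ->] /andP[ne tij]]|[j]].
  exists j => //; rewrite inE jJ tij andbT /=; by apply: contraNneq ne => ->.
rewrite inE => /and3P[jJ ji tij] ->; rewrite imset_f // tij andbT; split=> //.
by apply: contraNneq ji => /(inj _ _ jJ iJ) ->.
Qed.

Lemma iedges_bound t J phi : Kt_minor_free t G -> branch_fun J phi ->
  iedges J phi <= 2 ^ t * #|J|.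
Proof.
move=> free fJ; rewrite leqNgt; apply/negP => lt; apply: free.
have [J0|nJ] := eqVneq J set0.
  by move: lt; rewrite /iedges J0 big_set0.
have [||M [fM tM cM _]] := dense_clique_model (t := t) (branch_fun_imset fJ).
- by rewrite imset_eq0.
- by rewrite iedgesE // (card_in_imset (branch_fun_inj fJ)) ltnW.
- by apply: clique_minor fM tM _; rewrite cM.
Qed.

(* Each set of [F] that sees two non-adjacent branch sets is merged
   into one of them, which creates a new adjacency. *)
Lemma absorb t J phi F : Kt_minor_free t G -> branch_fun J phi -> branch_sets F ->
  (forall i Y, i \in J -> Y \in F -> [disjoint phi i & Y]) ->
  2 ^ t * #|J| < #|F| ->
  exists phi' Y, [/\ Y \in F, branch_fun J phi',
    forall i, i \in J -> phi i \subset phi' i,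
    forall i, i \in J -> [disjoint phi' i & Y] &
    {in J &, forall i j, i != j -> touch Y (phi i) -> touch Y (phi j) ->
      touch (phi' i) (phi' j)}].
Proof.
move=> free fJ fF dF lt.
(* This weaker inequality survives merging: a merge takes one set from [F] and raises [iedges] by at
   least one. By [iedges_bound] it fails when [F] is empty. *)
have {lt} : 2 ^ t * #|J| < #|F| + iedges J phi by apply: leq_trans lt (leq_addr _ _).
have [n] := ubnP #|F|; elim: n F phi fJ fF dF => // n IH F phi fJ fF dF le lt.
have [F0|/set0Pn[Y YF]] := eqVneq F set0.
  by have := iedges_bound free fJ; rewrite leqNgt; rewrite F0 cards0 in lt; rewrite lt.
have [[i [j [iJ jJ ij [ti tj ntij]]]]|all] := classic (exists i j, [/\ i \in J, j \in J,
    i != j & [/\ touch Y (phi i), touch Y (phi j) & ~~ touch (phi i) (phi j)]]); last first.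
  exists phi, Y; split=> //; first by move=> i iJ; exact: dF.
  move=> i j iJ jJ ij ti tj; have [//|nt] := boolP (touch (phi i) (phi j)).
  by case: all; exists i, j; split.
have [cY nY] := proj2 fF _ YF.
have cF := cardsD1 Y F; rewrite YF in cF.
have dY a : a \in J -> [disjoint phi a & Y] by move=> aJ; exact: dF.
have fJ' := branch_fun_update fJ iJ cY ti dY.
have e1 : iedges J phi < iedges J (update phi i Y).
  rewrite /iedges (bigD1 i) //= [in X in _ < X](bigD1 i) //= -addSn.
  have up a b : touch (phi a) (phi b) -> touch (update phi i Y a) (update phi i Y b).
    by apply: touchS; exact: update_sub.
  apply: leq_add; last first.
    apply: leq_sum => a _; apply/subset_leq_card/subsetP => b.
    by rewrite !inE => /and3P[-> -> /up].
  apply/proper_card/properP; split.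
    by apply/subsetP => b; rewrite !inE => /and3P[-> -> /up].
  exists j; rewrite !inE jJ eq_sym ij //=.
  by rewrite /update eqxx eq_sym (negPf ij) touchUl tj.
have [||||phi' [Z [ZF fphi' sub dZ tZ]]] := IH (F :\ Y) (update phi i Y) fJ'.
- by apply: branch_setsS fF; exact: subsetDl.
- move=> a Z aJ /setD1P[ZY ZF]; rewrite /update; case: eqP => _; last exact: dF.
  by rewrite disjoint_setU dF // (branch_sets_disjoint fF) // eq_sym.
- by move: le; rewrite cF.
- apply: leq_trans lt _; rewrite cF addSn addnC -addSn addnC addnS.
  by rewrite -addnS leq_add2l.
exists phi', Z; split=> //; first by case/setD1P: ZF.
- by move=> a aJ; apply: subset_trans (sub _ aJ); exact: update_sub.
- move=> a b aJ bJ ab ta tb; apply: tZ => //.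
    by apply: touchS ta => //; exact: update_sub.
  by apply: touchS tb => //; exact: update_sub.
Qed.

(** While [X] is not covered, connectedness gives an uncovered vertex adjacent to one of the sets,
    which takes it in. *)
Lemma branch_fun_cover X J phi : connected_in X -> J != set0 -> branch_fun J phi ->
  (forall i, i \in J -> phi i \subset X) ->
  exists phi', [/\ branch_fun J phi', forall i, i \in J -> phi i \subset phi' i &
    X = \bigcup_(i in J) phi' i].
Proof.
move=> cX nJ; have [n] := ubnP #|X :\: \bigcup_(i in J) phi i|.
elim: n phi => // n IH phi le fJ subX.
pose U := \bigcup_(i in J) phi i.
have UX : U \subset X by apply/bigcupsP.
have [XU|/subsetPn[x xX xU]] := boolP (X \subset U).
  by exists phi; split=> //; apply/eqP; rewrite eqEsubset XU.
have /set0Pn[i0 i0J] := nJ; have [_ /set0Pn[u ui0]] := proj1 fJ _ i0J.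
have uU : u \in U by apply/bigcupP; exists i0.
have [a [b [aX /bigcupP[i iJ ai] bX bU ab]]] :=
  connected_cut cX (subsetP UX _ uU) uU xX xU.
have fJ' : branch_fun J (update phi i [set b]).
  apply: branch_fun_update => //; first exact: (@connected1 _ b).
    by rewrite touch1l; apply/exists_inP; exists a => //; rewrite adj_sym.
  move=> j jJ; rewrite disjoint_sym disjoints1.
  by apply: contra bU => bj; apply/bigcupP; exists j.
have [|//||phi' [fphi' sub XE]] := IH (update phi i [set b]).
- rewrite -ltnS; apply: leq_ltn_trans le; apply: proper_card; apply/properP; split.
    apply: setDS; apply/bigcupsP => j jJ; apply: subset_trans (update_sub _ i [set b] _) _.
    exact: bigcup_sup.
  exists b; first by rewrite inE bU.
  rewrite inE negb_and negbK; apply/orP; left; apply/bigcupP; exists i => //.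
  by rewrite /update eqxx !inE eqxx.
- move=> j jJ; rewrite /update; case: eqP => _; last exact: subX.
  by rewrite subUset sub1set bX subX.
exists phi'; split=> // j jJ; apply: subset_trans (sub _ jJ).
exact: update_sub.
Qed.

End IndexedFamilies.

(** * Disjoint connected sets attached to many vertices *)

(** Used with [T] a clique of terminals produced by [absorb] and [L] one or two further sets
    attached to all of it. *)
Lemma joined_cliques_minor (G : graph) (I : finType) t (T : {set I})
    (phi : I -> {set G}) (L : {set {set G}}) :
  branch_fun T phi -> {in T &, forall i j, i != j -> touch (phi i) (phi j)} ->
  branch_sets L -> pairwise_touching L ->
  (forall i Z, i \in T -> Z \in L -> [disjoint phi i & Z] && touch Z (phi i)) ->
  t <= #|T| + #|L| -> is_minor (K t) G.
Proof.
move=> fT tT fL tL TL le.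
have fI := branch_fun_imset fT.
have TLd i Z : i \in T -> Z \in L -> phi i != Z.
  move=> iT ZL; apply: contraTneq (TL _ _ iT ZL) => ->.
  by rewrite -setI_eq0 setIid; have [_ /negPf->] := proj2 fL _ ZL.
apply: (@clique_minor _ t (phi @: T :|: L)).
- split=> [|A /setUP[AI|AL]]; [|exact: proj2 fI _ AI|exact: proj2 fL _ AL].
  apply/trivIsetP => A B /setUP[AI|AL] /setUP[BI|BL] AB.
  + exact: branch_sets_disjoint fI AI BI AB.
  + by case/imsetP: AI => i iT ->; have /andP[] := TL _ _ iT BL.
  + by case/imsetP: BI => i iT ->; rewrite disjoint_sym; have /andP[] := TL _ _ iT AL.
  + exact: branch_sets_disjoint fL AL BL AB.
- move=> A B /setUP[/imsetP[i iT ->]|AL] /setUP[/imsetP[j jT ->]|BL] AB.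
  + by apply: tT => //; apply: contraNneq AB => ->.
  + by rewrite touch_sym; have /andP[] := TL _ _ iT BL.
  + by have /andP[] := TL _ _ jT AL.
  + exact: tL.
- rewrite cardsU (card_in_imset (branch_fun_inj fT)).
  rewrite (_ : _ :&: _ = set0) ?cards0 ?subn0 //.
  apply/setP => Z; rewrite !inE; apply/negP => /andP[/imsetP[i iT ->] iL].
  by have := TLd _ _ iT iL; rewrite eqxx.
Qed.

Section FewDisjoint.
Variables (G : graph) (c : nat).
Hypothesis free : Kt_minor_free c.+2 G.
Implicit Types (A X Y Z : {set G}) (F W : {set {set G}}).

Lemma branch_fun_set1 A : branch_fun A (fun a : G => [set a]).
Proof.
split=> [a _|a b _ _ ab]; first by split; [exact: (@connected1 _ a)|by apply/set0Pn; exists a; rewrite set11].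
by rewrite disjoints1 inE.
Qed.

Definition attach A Y := [set a in A | touch Y [set a]].

Lemma attachS A Y Y' : Y \subset Y' -> attach A Y \subset attach A Y'.
Proof.
move=> s; apply/subsetP => a; rewrite !inE => /andP[-> h].
exact: touchS s (subxx _) h.
Qed.

Definition ends (p : {set G} * {set G}) := [set p.1; p.2].

(* If neither of two touching sets attaches to c.+1 elements of the clique, they
   attach to the same c of them. *)
Lemma few_touching_pairs A F (P : {set {set G} * {set G}}) :
  branch_sets F -> (forall Y, Y \in F -> [disjoint A & Y]) ->
  (forall Y, Y \in F -> c <= #|attach A Y|) ->
  (forall p, p \in P -> [/\ p.1 \in F, p.2 \in F, p.1 != p.2 & touch p.1 p.2]) ->
  {in P &, forall p q, p != q -> [disjoint ends p & ends q]} ->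
  #|P| <= 2 ^ c.+2 * #|A|.
Proof.
move=> fF AF attF PF disP; rewrite leqNgt; apply/negP => lt.
(* Each pair is absorbed as a single set, its union. *)
pose join (p : {set G} * {set G}) := p.1 :|: p.2.
have disj Y Z : Y \in F -> Z \in F -> Y != Z -> [disjoint Y & Z].
  exact: branch_sets_disjoint.
have dP p q : p \in P -> q \in P -> p != q -> [disjoint join p & join q].
  move=> pP qP pq; have [p1 p2 _ _] := PF _ pP; have [q1 q2 _ _] := PF _ qP.
  have := disP _ _ pP qP pq; rewrite -setI_eq0 => /eqP/setP dpq.
  have ne Y Z : Y \in ends p -> Z \in ends q -> Y != Z.
    by move=> Yp Zq; apply/eqP => e; have := dpq Y; rewrite !inE -!in_set2 Yp e Zq.
  rewrite disjoint_setU !(disjoint_sym _ (join q)) !disjoint_setU.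
  by rewrite !disj //; rewrite 1?eq_sym ne ?inE ?eqxx ?orbT.
have join0 p : p \in P -> connected_in (join p) /\ join p != set0.
  move=> pP; have [p1 p2 _ tp] := PF _ pP.
  have [[c1 n1] [c2 _]] := (proj2 fF _ p1, proj2 fF _ p2).
  split; first by apply: connectedU; rewrite ?tp.
  by rewrite setU_eq0 (negPf n1).
have fP : branch_fun P join by [].
have := absorb free (branch_fun_set1 A) (branch_fun_imset fP).
rewrite (card_in_imset (branch_fun_inj fP)) => /(_ _ lt)[].
  move=> a Y aA /imsetP[p /PF[p1 p2 _ _] ->]; rewrite disjoint_sym disjoint_setU.
  by rewrite !(disjoint_sym _ [set a]) !(disjointWl _ (AF _ _)) ?sub1set.
move=> phi [_ [/imsetP[[Y Z] pP ->] fphi sub dis tch]] {lt}.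
have [/= YF ZF YZ tYZ] := PF _ pP.
have TA Y' : attach A Y' \subset A by apply/subsetP => a; rewrite inE => /andP[].
pose T := attach A Y :|: attach A Z.
have TsA : T \subset A by rewrite subUset !TA.
have tT : {in T &, forall i j, i != j -> touch (phi i) (phi j)}.
  have tj a : a \in T -> touch (join (Y, Z)) [set a].
    by rewrite touchUl !inE => /orP[]/andP[_ ->]; rewrite ?orbT.
  by move=> a b aT bT ab; apply: tch; rewrite ?(subsetP TsA) ?tj.
have fT := branch_funS TsA fphi.
(* More than c terminals together with the union of [Y] and [Z] already give c + 2 branch sets. *)
have [big|small] := ltnP c #|T|.
  apply: free; apply: (joined_cliques_minor (L := [set join (Y, Z)]) fT tT).
  - split=> [|_ /set1P->]; last exact: join0.
    by apply/trivIsetP => ? ? /set1P-> /set1P->; rewrite eqxx.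
  - by move=> ? ? /set1P-> /set1P->; rewrite eqxx.
  - move=> a _ aT /set1P->; rewrite dis ?(subsetP TsA) //=.
    apply: (@touchS _ (join (Y, Z)) [set a]) => //; first by rewrite sub ?(subsetP TsA).
    by move: aT; rewrite touchUl !inE => /orP[]/andP[_ ->]; rewrite ?orbT.
  - by rewrite cards1 addn1 ltnS.
(* Otherwise [Y] and [Z] both attach to all of [T], and they count as two branch sets beside at
   least c terminals. *)
have eqT Y' : Y' \in F -> attach A Y' \subset T -> attach A Y' = T.
  move=> Y'F s; apply/eqP; rewrite eqEcard s /=.
  exact: leq_trans small (attF _ Y'F).
have eY := eqT _ YF (subsetUl _ _); have eZ := eqT _ ZF (subsetUr _ _).
apply: free; apply: (joined_cliques_minor (L := [set Y; Z]) fT tT).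
- by apply: branch_setsS fF; rewrite subUset !sub1set YF.
- move=> ? ? /set2P[]-> /set2P[]->; rewrite ?eqxx // => _.
  by rewrite touch_sym.
- move=> a U aT UYZ; have aA := subsetP TsA _ aT.
  have sU : U \subset join (Y, Z).
    by case/set2P: UYZ => ->; [exact: subsetUl|exact: subsetUr].
  rewrite (disjointWr sU) ?dis //=; apply: (@touchS _ U [set a]) (sub _ aA) _ => //.
  by move: aT; case/set2P: UYZ => ->; [rewrite -eY|rewrite -eZ]; rewrite inE => /andP[].
- by rewrite cards2 YZ addn2 !ltnS -eY attF.
Qed.

(** Boolean, so that [arg_maxnP] yields a largest matching. *)
Definition matching F (P : {set {set G} * {set G}}) :=
  [forall p in P, [&& p.1 \in F, p.2 \in F, p.1 != p.2 & touch p.1 p.2]] &&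
  [forall p in P, forall q in P, (p != q) ==> [disjoint ends p & ends q]].

(* By maximality of the matching, each unmatched set touches a matched one, which
   serves as an additional terminal: this gives c.+1 attachments. *)
Lemma few_disjoint_cover A X F :
  connected_in X -> X = cover F -> branch_sets F -> 1 < #|F| ->
  (forall Y, Y \in F -> [disjoint A & Y]) ->
  (forall Y, Y \in F -> c <= #|attach A Y|) ->
  #|F| <= 2 ^ c.+2 * (3 + 2 * 2 ^ c.+2) * #|A|.
Proof.
move=> cX XE fF F2 AF attF; pose k := 2 ^ c.+2.
have mP0 : matching F set0.
  by apply/andP; split; apply/forall_inP => p; rewrite inE.
case: (@arg_maxnP _ set0 (matching F) (fun P => #|P|) mP0) => P /andP[P1 P2] maxP.
have PF p : p \in P -> [/\ p.1 \in F, p.2 \in F, p.1 != p.2 & touch p.1 p.2].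
  by move=> /(forall_inP P1)/and4P.
have disP : {in P &, forall p q, p != q -> [disjoint ends p & ends q]}.
  by move=> p q pP qP; apply/implyP; exact: (forall_inP (forall_inP P2 _ pP)).
have cP := few_touching_pairs fF AF attF PF disP.
pose W := \bigcup_(p in P) ends p.
have cW : #|W| <= 2 * #|P|.
  rewrite mulnC -sum_nat_const; apply: leq_trans (_ : _ <= \sum_(p in P) #|ends p|) _.
    rewrite /W; elim/big_ind2: _ => [|a A' b C hA hC|//]; first by rewrite cards0.
    by apply: leq_trans (leq_card_setU _ _) _; exact: leq_add.
  by apply: leq_sum => p _; rewrite cards2; case: (_ != _).
have WF : W \subset F.
  apply/bigcupsP => p /PF[p1 p2 _ _]; apply/subsetP => Y /set2P[]->//.
(* As [X] is connected and covered by [F], an edge leads from [Y] into another set [Z]. If [Z] were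
   unmatched too, the pair would extend the matching. *)
have near Y : Y \in F :\: W -> exists2 Z, Z \in W & touch Y Z.
  move=> /setDP[YF YW]; have [cY /set0Pn[y yY]] := proj2 fF _ YF.
  have YX : Y \subset X by rewrite XE; exact: bigcup_sup.
  have [Z0 Z0F Z0Y] : exists2 Z0, Z0 \in F & Z0 != Y.
    have := cardsD1 Y F; rewrite YF => cF; rewrite cF in F2.
    have /card_gt0P[Z0] : 0 < #|F :\ Y| by [].
    by case/setD1P => ne Z0F; exists Z0.
  have [_ /set0Pn[z zZ0]] := proj2 fF _ Z0F.
  have zX : z \in X by rewrite XE; apply/bigcupP; exists Z0.
  have zY : z \notin Y.
    by rewrite (disjointFr (branch_sets_disjoint fF Z0F YF Z0Y)).
  have [a [b [aX aY bX bY ab]]] := connected_cut cX (subsetP YX _ yY) yY zX zY.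
  move: bX; rewrite XE => /bigcupP[Z ZF bZ].
  have YZ : Y != Z by apply: contraNneq bY => ->.
  have tYZ : touch Y Z by apply/touchP; exists a, b.
  exists Z => //; apply/negPn/negP => ZW.
  have YZP : (Y, Z) \notin P.
    by apply: contra YW => h; apply/bigcupP; exists (Y, Z); rewrite // !inE eqxx.
  have dYZ p : p \in P -> [disjoint ends (Y, Z) & ends p].
    move=> pP; apply/pred0Pn => -[U /= /andP[/set2P[]-> h]].
      by case/negP: YW; apply/bigcupP; exists p.
    by case/negP: ZW; apply/bigcupP; exists p.
  have : matching F ((Y, Z) |: P).
    apply/andP; split; apply/forall_inP => p /setU1P[->|pP] /=.
    - by rewrite YF ZF YZ.
    - by apply/and4P; exact: PF.
    - apply/forall_inP => q /setU1P[->|qP]; first by rewrite eqxx.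
      by apply/implyP => _; exact: dYZ.
    - apply/forall_inP => q /setU1P[->|qP]; apply/implyP; last exact: disP.
      by move=> _; rewrite disjoint_sym dYZ.
  by move/maxP; rewrite cardsU1 YZP /= add1n ltnn.
(* The terminals are of two sorts, vertices of [A] and matched sets. *)
pose I : finType := (G + {set G})%type.
pose phi0 (i : I) : {set G} := match i with inl a => [set a] | inr Z => Z end.
pose J : {set I} := [set inl a | a in A] :|: [set inr Z | Z in W].
have inlJ a : ((inl a : I) \in J) = (a \in A).
  rewrite inE (mem_imset _ _ (inl_inj (B := _))).
  by case: (boolP (a \in A)) => //= _; apply/imsetP => -[].
have inrJ Z : ((inr Z : I) \in J) = (Z \in W).
  rewrite inE (mem_imset _ _ (inr_inj (A := _))) orbC.
  by case: (boolP (Z \in W)) => //= _; apply/imsetP => -[].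
have cJ : #|J| = #|A| + #|W|.
  rewrite cardsU (card_imset _ (inl_inj (B := _))) (card_imset _ (inr_inj (A := _))).
  rewrite (_ : _ :&: _ = set0) ?cards0 ?subn0 //.
  by apply/setP => i; rewrite !inE; apply/negP => /andP[/imsetP[a _ ->] /imsetP[]].
have fJ : branch_fun J phi0.
  split=> [[a|Z]|[a|Y] [b|Z]]; rewrite ?inlJ ?inrJ /=.
  - by move=> aA; apply: (proj1 (branch_fun_set1 A)).
  - by move/(subsetP WF); exact: (proj2 fF).
  - by move=> aA bA ab; rewrite disjoints1 inE; apply: contraNneq ab => ->.
  - move=> aA /(subsetP WF)/AF dZ _; by apply: disjointWl dZ; rewrite sub1set.
  - move=> /(subsetP WF)/AF dZ aA _; rewrite disjoint_sym.
    by apply: disjointWl dZ; rewrite sub1set.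
  - move=> /(subsetP WF) YF /(subsetP WF) ZF ne; apply: branch_sets_disjoint fF YF ZF _.
    by apply: contraNneq ne => ->.
have cO : #|F :\: W| <= k * #|J|.
  rewrite leqNgt; apply/negP => lt.
  have [||phi [Y [YO fphi sub dis tch]]] := absorb free fJ _ _ lt.
  - by apply: branch_setsS fF; exact: subsetDl.
  - move=> [a|Z] Y; rewrite ?inlJ ?inrJ /= => h /setDP[YF YW].
      by apply: disjointWl (AF _ YF); rewrite sub1set.
    apply: branch_sets_disjoint fF (subsetP WF _ h) YF _.
    by apply: contraNneq YW => <-.
  have [Z ZW tYZ] := near _ YO; have /setDP[YF _] := YO.
  (* The matched set [Z] joins at least c attachments in [A]; with [Y] this makes c + 2 branch
     sets. *)
  pose T : {set I} := inr Z |: [set inl a | a in attach A Y].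
  have TP i : i \in T -> i \in J /\ touch Y (phi0 i).
    case/setU1P => [->|/imsetP[a]]; first by rewrite inrJ.
    by rewrite inE => /andP[aA ta] ->; rewrite inlJ.
  have TJ : T \subset J by apply/subsetP => i /TP[].
  apply: free; apply: (joined_cliques_minor (L := [set Y]) (branch_funS TJ fphi)).
  - by move=> i j /TP[iJ ti] /TP[jJ tj] ij; exact: tch.
  - by apply: branch_setsS fF; rewrite sub1set.
  - by move=> ? ? /set1P-> /set1P->; rewrite eqxx.
  - move=> i _ /TP[iJ ti] /set1P->; rewrite dis //=.
    exact: touchS (subxx _) (sub _ iJ) ti.
  - rewrite cards1 addn1 ltnS cardsU1 (card_imset _ (inl_inj (B := _))).
    rewrite (_ : _ \notin _) ?ltnS ?attF //.
    by apply/imsetP => -[].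
have cF : #|F| = #|W| + #|F :\: W|.
  by rewrite -(cardsID W F) (setIidPr WF).
rewrite -/k in cP *; move: cP cW cO; rewrite cJ cF.
move: k #|P| #|W| #|A| #|_ :\: _|; clear => k p w a o cP cW cO.
(* From p <= k a, w <= 2 p and o <= k (a + w) the total w + o is at most (3 k + 2 k^2) a. *)
have := leq_mul (leqnn k) cW; have := leq_mul (leqnn k) cP; nia.
Qed.

(** Enlarging the sets until they cover [X] can only add attachments. The summand 1 accounts for
    families of at most one set. *)
Lemma few_disjoint_touching A X F :
  connected_in X -> [disjoint A & X] -> branch_sets F ->
  (forall Y, Y \in F -> Y \subset X) ->
  (forall Y, Y \in F -> c <= #|attach A Y|) ->
  #|F| <= 2 ^ c.+2 * (3 + 2 * 2 ^ c.+2) * #|A| + 1.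
Proof.
move=> cX AX fF FX attF.
have [F1|F2] := leqP #|F| 1; first by apply: leq_trans F1 (leq_addl _ _).
have fid : branch_fun F id.
  by split=> [|Y Z]; [exact: (proj2 fF)|exact: branch_sets_disjoint].
have F0 : F != set0 by rewrite -card_gt0 ltnW.
have [phi [fphi sub XE]] := branch_fun_cover cX F0 fid FX.
have cF : #|phi @: F| = #|F| by rewrite (card_in_imset (branch_fun_inj fphi)).
rewrite -cF; apply: leq_trans (leq_addr _ _); apply: (@few_disjoint_cover _ X).
- exact: cX.
- by rewrite XE /cover big_imset //=; exact: branch_fun_inj.
- exact: branch_fun_imset.
- by rewrite cF.
- move=> _ /imsetP[Y YF ->]; apply: disjointWr AX.
  by rewrite XE; exact: bigcup_sup.
- move=> _ /imsetP[Y YF ->]; apply: leq_trans (attF _ YF) _.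
  by apply/subset_leq_card/attachS/sub.
Qed.

End FewDisjoint.

(** * Construction of the partition *)

(** The bound of [few_disjoint_touching] for at most [c] seen parts with [k.*2.+1] attachment
    vertices in each. *)
Definition hitting_number (c k : nat) :=
  2 ^ c.+2 * (3 + 2 * 2 ^ c.+2) * (c * k.*2.+1) + 1.

(** The 2 comes from the closure under least common ancestors, the [k.+1] from the size of a bag. *)
Definition part_width (c k : nat) := 2 * hitting_number c k * k.+1.

Section Partition.
Variables (G : graph) (c k : nat) (rk : G -> nat) (B : G -> {set G}).
Hypothesis elimB : elim_scheme k rk B.
Hypothesis free : Kt_minor_free c.+2 G.
Implicit Types (D Q X Y : {set G}) (p : G -> G) (rh : G -> nat) (BB : G -> {set G}).

Definition seen D p Y := p @: attach D Y.

(* A partition of the placed set [D]; a part is labelled by one of its vertices,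
   and [rh], [BB] form an elimination scheme on the labels. *)
Record partial_partition D p rh BB : Prop := PartialPartition {
  pp_label : forall v, v \in D -> p v \in D;
  pp_width : forall x, #|[set v in D | p v == x]| <= part_width c k;
  pp_edge : forall u v, u \in D -> v \in D -> adj u v ->
    [\/ p u = p v, p u \in BB (p v) | p v \in BB (p u)];
  pp_bag : forall x, BB x \subset D;
  pp_rank : forall x, x \in D -> rh x < #|D|;
  pp_rk : forall u x, u \in BB x -> rh u < rh x;
  pp_chordal : forall u v x, u \in BB x -> v \in BB x ->
    [\/ u = v, u \in BB v | v \in BB u];
  pp_bag_card : forall x, #|BB x| <= c;
  pp_seen_card : forall Y, connected_in Y -> Y != set0 -> [disjoint Y & D] ->
    #|seen D p Y| <= c;
  pp_seen_clique : forall Y, connected_in Y -> Y != set0 -> [disjoint Y & D] ->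
    forall u v, u \in seen D p Y -> v \in seen D p Y ->
    [\/ u = v, u \in BB v | v \in BB u];
  pp_few : forall Y x, connected_in Y -> Y != set0 -> [disjoint Y & D] ->
    #|[set v in attach D Y | p v == x]| <= k.*2.+1 }.

(** Seeing fewer than [c] old parts leaves room for [Q] among the parts that a remaining set
    sees. *)
Lemma next_part D p rh BB X :
  partial_partition D p rh BB -> connected_in X -> X != set0 -> [disjoint X & D] ->
  exists Q, [/\ Q \subset X, Q != set0, #|Q| <= part_width c k,
    forall Y, connected_in Y -> Y != set0 -> Y \subset X :\: Q ->
      #|attach Q Y| <= k.*2.+1 &
    forall Y, connected_in Y -> Y != set0 -> Y \subset X :\: Q ->
      #|seen D p Y| < c].
Proof.
move=> pp cX nX dX; have /set0Pn[v vX] := nX.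
have seenS Y : Y \subset X -> seen D p Y \subset seen D p X.
  by move=> YX; apply/imsetS/attachS.
have [lt|ge] := ltnP #|seen D p X| c.
  exists [set v]; split.
  - by rewrite sub1set.
  - by apply/set0Pn; exists v; rewrite set11.
  - by rewrite cards1 /part_width /hitting_number addn1; lia.
  - move=> Y _ _ _; apply: (@leq_trans #|[set v]|); last by rewrite cards1.
    by apply/subset_leq_card/subsetP => u; case/setIdP.
  - move=> Y _ _; rewrite subsetD => /andP[YX _]; apply: leq_ltn_trans lt.
    exact: subset_leq_card (seenS _ YX).
pose A := attach D X.
have cA : #|A| <= c * k.*2.+1.
  rewrite -sum1_card (partition_big_imset p) /=.
  apply: leq_trans (_ : \sum_(x in p @: A) k.*2.+1 <= _).
    apply: leq_sum => x _; rewrite sum1dep_card; exact: (pp_few pp x cX nX dX).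
  by rewrite sum_nat_const leq_mul2r (pp_seen_card pp cX nX dX) orbT.
have AX : [disjoint A & X].
  rewrite disjoint_sym; apply: disjointWr dX.
  by apply/subsetP => u; rewrite inE => /andP[].
have attA Y : Y \subset X -> attach A Y = attach D Y.
  move=> YX; apply/setP => u; rewrite !inE.
  have [tY|_] := boolP (touch Y [set u]); last by rewrite !andbF.
  by rewrite (touchS YX (subxx _) tY) !andbT.
pose good Y := [/\ connected_in Y, Y != set0, Y \subset X & c <= #|seen D p Y|].
have gP Y : good Y -> connected_in Y /\ Y != set0 by case.
(* A good set has an attachment vertex in each of its [c] seen parts, so [few_disjoint_touching]
   excludes the first alternative. *)
case: (erdos_posa elimB (hitting_number c k) gP) => [[F [tF cF gF]]|[W [cW hW]]].
  have fF : branch_sets F by split=> // Y /gF[].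
  have FX Y : Y \in F -> Y \subset X by move/gF => [].
  have attF Y : Y \in F -> c <= #|attach A Y|.
    case/gF => _ _ YX le; rewrite attA //.
    exact: leq_trans le (leq_imset_card _ _).
  have := few_disjoint_touching free cX AX fF FX attF.
  rewrite cF /hitting_number ltnNge => /negP[].
  by rewrite leq_add2r leq_mul2l cA orbT.
have [Z [WZ cZ closZ]] := lca_closure elimB W.
have off Y : Y \subset X :\: (X :&: bags B Z) -> [disjoint Y & bags B Z].
  move=> /subsetP YX; apply/pred0P => y /=; apply/negP => /andP[yY yZ].
  by have := YX _ yY; rewrite !inE yZ andbT; case: (y \in X).
exists (X :&: bags B Z); split.
- exact: subsetIl.
- by apply: (meets_bags WZ); apply: hW.
- apply: leq_trans (subset_leq_card (subsetIr _ _)) _.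
  apply: leq_trans (card_bags elimB Z) _; rewrite /part_width leq_mul2r /=.
  by apply: leq_trans cZ _; rewrite leq_mul2l.
- move=> Y cY nY YX.
  apply: leq_trans (few_bag_neighbours elimB closZ cY nY (off _ YX)).
  apply/subset_leq_card/subsetP => u; rewrite !inE => /andP[/andP[_ uZ] tY].
  rewrite uZ /=; case/touchP: tY => y [z [yY /set1P-> yz]].
  by apply/exists_inP; exists y.
- move=> Y cY nY YX; rewrite ltnNge; apply/negP => le.
  have gY : good Y by split=> //; move: YX; rewrite subsetD => /andP[].
  have /set0Pn[y /setIP[yY yZ]] := meets_bags WZ (hW _ gY).
  by have := disjointFr (off _ YX) yY; rewrite yZ.
Qed.

Lemma extend_partition D p rh BB : partial_partition D p rh BB -> D != setT ->
  exists D' p' rh' BB', partial_partition D' p' rh' BB' /\ #|D| < #|D'|.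
Proof.
move=> pp DT.
have [v vD] : exists v, v \in ~: D.
  by apply/set0Pn; apply: contraNneq DT => e; rewrite -(setCK D) e setC0.
have [X [vX XD cX maxX]] := component_exists vD.
have nX : X != set0 by apply/set0Pn; exists v.
have dX : [disjoint X & D] by rewrite disjoints_subset.
have [Q [QX /set0Pn[q qQ] cQ fewQ seenQ]] := next_part pp cX nX dX.
(* [q] labels the new part. Its rank [#|D|] exceeds the earlier ones by [pp_rank], and its earlier
   neighbours are all the parts that [X] sees. *)
pose p' u := if u \in Q then q else p u.
pose rh' x := if x \in Q then #|D| else rh x.
pose BB' x := if x \in Q then seen D p X else BB x.
have QD u : u \in Q -> u \notin D.
  by move=> /(subsetP QX) uX; rewrite (disjointFr dX).
have qD := QD _ qQ.
have Dq x : x \in D -> (x == q) = false.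
  by move=> xD; apply: contraNF qD => /eqP <-.
have p'D u : u \in D -> p' u = p u.
  by move=> uD; rewrite /p'; case: ifP => // /QD; rewrite uD.
have p'Dq u : u \in D -> (p' u == q) = false.
  by move=> uD; rewrite p'D // Dq // (pp_label pp).
have p'Q u : u \in Q -> p' u = q by rewrite /p' => ->.
have seenD Y : seen D p Y \subset D.
  by apply/subsetP => _ /imsetP[u /setIdP[uD _] ->]; exact: (pp_label pp).
have DQ x : x \in D -> (x \in Q) = false by move=> xD; apply: contraTF xD => /QD.
have BB'D x : x \in D -> BB' x = BB x by move=> xD; rewrite /BB' DQ.
have rh'D x : x \in D -> rh' x = rh x by move=> xD; rewrite /rh' DQ.
have cD' : #|D :|: Q| = #|D| + #|Q|.
  rewrite cardsU (_ : D :&: Q = set0) ?cards0 ?subn0 //.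
  by apply/setP => u; rewrite !inE; case: (boolP (u \in Q)) => [/QD/negPf->|]; rewrite ?andbF.
have lt : #|D| < #|D :|: Q|.
  by rewrite cD' -addn1 leq_add2l card_gt0; apply/set0Pn; exists q.
(* [X] is a component of the unplaced vertices, so a connected unplaced set that touches [Q] lies in
   [X]. *)
have away Y : connected_in Y -> Y != set0 -> [disjoint Y & D :|: Q] ->
    (Y \subset X :\: Q) \/ attach Q Y = set0.
  move=> cY nY; rewrite disjoint_sym disjoint_setU => /andP[dYD dYQ].
  have [->|/set0Pn[u]] := eqVneq (attach Q Y) set0; first by right.
  case/setIdP => uQ tYu; left; rewrite subsetD (disjoint_sym Y) dYQ andbT.
  apply: maxX => //; first by rewrite -disjoints_subset disjoint_sym.
  by rewrite touch_sym (touchS (subxx _) _ tYu) // sub1set (subsetP QX).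
have offD Y : [disjoint Y & D :|: Q] -> [disjoint Y & D].
  by rewrite disjoint_sym disjoint_setU => /andP[+ _]; rewrite disjoint_sym.
have seen' Y : seen (D :|: Q) p' Y =
    seen D p Y :|: (if attach Q Y == set0 then set0 else [set q]).
  apply/setP => x; apply/imsetP/setUP => [[u]|[/imsetP[u]|]].
  - rewrite !inE => /andP[/orP[uD|uQ] tu] ->.
      by left; rewrite p'D //; apply: imset_f; rewrite inE uD.
    right; rewrite p'Q //; case: eqP => [/setP/(_ u)|_]; last exact: set11.
    by rewrite !inE uQ tu.
  - by case/setIdP => uD tu ->; exists u; rewrite ?p'D // !inE uD.
  - case: eqVneq => [_|/set0Pn[u /setIdP[uQ tu]]]; first by rewrite inE.
    move/set1P ->.
    by exists u; rewrite ?p'Q // !inE uQ orbT.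
exists (D :|: Q), p', rh', BB'; split=> //; split.
- move=> u /setUP[uD|uQ]; rewrite inE; first by rewrite p'D // (pp_label pp).
  by rewrite p'Q // qQ orbT.
- move=> x; have [->|xq] := eqVneq x q.
    apply: leq_trans cQ; apply/subset_leq_card/subsetP => u.
    by rewrite !inE => /andP[/orP[uD|//]]; rewrite p'Dq.
  apply: leq_trans (pp_width pp x); apply/subset_leq_card/subsetP => u.
  rewrite !inE => /andP[/orP[uD|uQ]]; first by rewrite p'D // uD.
  by rewrite p'Q // eq_sym (negPf xq).
- have mixed u w : u \in Q -> w \in D -> adj u w -> p' w \in BB' (p' u).
    move=> uQ wD uw; rewrite (p'Q u) // /BB' qQ p'D //; apply: imset_f.
    rewrite inE wD; apply/touchP; exists u, w; rewrite set11.
    by rewrite (subsetP QX).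
  move=> u w /setUP[uD|uQ] /setUP[wD|wQ] uw.
  + by rewrite !p'D // !BB'D ?(pp_label pp) //; exact: (pp_edge pp uD wD uw).
  + by apply: Or32; apply: mixed => //; rewrite adj_sym.
  + by apply: Or33; exact: mixed.
  + by apply: Or31; rewrite !p'Q.
- move=> x; rewrite /BB'; case: ifP => _; apply: subset_trans (subsetUl _ _).
    exact: seenD.
  exact: (pp_bag pp x).
- move=> x /setUP[xD|xQ].
    by rewrite rh'D //; apply: ltn_trans lt; exact: (pp_rank pp xD).
  by rewrite /rh' xQ.
- move=> u x; rewrite /BB' /rh'; case: ifP => _ ux.
    have uD := subsetP (seenD X) _ ux.
    by rewrite DQ // (pp_rank pp).
  by rewrite DQ ?(pp_rk pp) // (subsetP (pp_bag pp x)).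
- move=> u w x; rewrite {1 2}/BB'; case: ifP => _ ux wx.
    rewrite !BB'D ?(subsetP (seenD X)) //; exact: (pp_seen_clique pp cX nX dX).
  rewrite !BB'D ?(subsetP (pp_bag pp x)) //; exact: (pp_chordal pp ux wx).
- move=> x; rewrite /BB'; case: ifP => _; last exact: (pp_bag_card pp x).
  exact: (pp_seen_card pp cX nX dX).
- move=> Y cY nY dY; rewrite seen'; case: (away _ cY nY dY) => [YX|->]; last first.
    by rewrite eqxx setU0 (pp_seen_card pp cY nY (offD _ dY)).
  apply: leq_trans (leq_card_setU _ _) _; have := seenQ _ cY nY YX.
  by case: ifP; rewrite ?cards0 ?cards1 ?addn0 ?addn1 // => _ /ltnW.
- move=> Y cY nY dY u w.
  have old a b : a \in seen D p Y -> b \in seen D p Y ->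
      [\/ a = b, a \in BB' b | b \in BB' a].
    move=> aY bY; rewrite !BB'D ?(subsetP (seenD Y)) //.
    exact: (pp_seen_clique pp cY nY (offD _ dY)).
  rewrite seen'; case: (away _ cY nY dY) => [YX|->]; last first.
    by rewrite eqxx setU0; exact: old.
  (* Whatever [Y] sees was seen by [X], hence is adjacent to the new part. *)
  have new a : a \in seen D p Y -> a \in BB' q.
    rewrite /BB' qQ; apply/subsetP/imsetS/attachS.
    by apply: subset_trans YX _; exact: subsetDl.
  have in2 a : a \in (if attach Q Y == set0 then set0 else [set q]) -> a = q.
    by case: ifP; rewrite inE // => _ /eqP.
  case/setUP => [uY|/in2->] /setUP[wY|/in2->]; first exact: old.
  + by apply: Or32; exact: new.
  + by apply: Or33; exact: new.
  + exact: Or31.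
- move=> Y x cY nY dY; have [->|xq] := eqVneq x q.
    apply: leq_trans (_ : #|attach Q Y| <= _).
      apply/subset_leq_card/subsetP => u.
      by rewrite !inE => /andP[/andP[/orP[uD|->//]]]; rewrite p'Dq.
    case: (away _ cY nY dY) => [YX|->]; first exact: fewQ.
    by rewrite cards0.
  apply: leq_trans (pp_few pp x cY nY (offD _ dY)).
  apply/subset_leq_card/subsetP => u.
  rewrite !inE => /andP[/andP[/orP[uD|uQ] ->]]; first by rewrite p'D // uD.
  by rewrite p'Q // eq_sym (negPf xq).
Qed.

Lemma total_partition : exists p rh BB, partial_partition [set: G] p rh BB.
Proof.
have start : partial_partition set0 id (fun=> 0) (fun=> set0).
  have att0 Y : attach set0 Y = set0 by apply/setP => u; rewrite !inE.
  have seen0 Y : seen set0 id Y = set0 by rewrite /seen att0 imset0.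
  split; try by move=> *; rewrite ?inE ?cards0 ?seen0 ?cards0 // in_set0.
  - by move=> v; rewrite inE.
  - move=> x; rewrite (_ : [set _ in _ | _] = set0) ?cards0 //.
    by apply/setP => u; rewrite !inE.
  - by move=> u v; rewrite inE.
  - by move=> x; rewrite inE.
  - by move=> u x; rewrite inE.
  - by move=> u v x; rewrite inE.
  - by move=> Y _ _ _ u v; rewrite seen0 inE.
  - move=> Y x _ _ _; rewrite att0 (_ : [set _ in _ | _] = set0) ?cards0 //.
    by apply/setP => u; rewrite !inE.
have grow D p rh BB : partial_partition D p rh BB ->
    exists p rh BB, partial_partition [set: G] p rh BB.
  have [n] := ubnP (#|G| - #|D|); elim: n D p rh BB => // n IH D p rh BB le pp.
  have [DT|DT] := eqVneq D setT; first by exists p, rh, BB; rewrite -DT.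
  have [D' [p' [rh' [BB' [pp' lt]]]]] := extend_partition pp DT.
  apply: IH pp'; have := max_card (mem D').
  by move: lt le; clear; move: #|D| #|D'| #|G| => a b m; lia.
exact: grow start.
Qed.

Lemma tpw_le_part_width : tpw_le c G (part_width c k).
Proof.
have [p [rh [BB pp]]] := total_partition.
(* [H] is built on the vertices of [G]; a vertex that labels no part has an empty part. *)
pose e : rel G := fun x y => (x \in BB y) || (y \in BB x).
have e_sym : symmetric e by move=> x y; rewrite /e orbC.
have e_irr : irreflexive e.
  by move=> x; rewrite /e orbb; apply/negP => /(pp_rk pp); rewrite ltnn.
exists (Graph e_sym e_irr), p; split; [|split].
- apply: (@elim_tw_le (Graph e_sym e_irr) c rh BB); split.
  + exact: (pp_rk pp).
  + by move=> u v /orP.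
  + exact: (pp_chordal pp).
  + exact: (pp_bag_card pp).
- move=> v w vw; rewrite /adj /= /e.
  case: (pp_edge pp (in_setT v) (in_setT w) vw) => [->|->|->]; rewrite ?orbT; by [left|right].
- move=> x; apply: leq_trans (pp_width pp x).
  by apply/subset_leq_card/subsetP => v; rewrite !inE.
Qed.

End Partition.

(** * The quadratic bound and the theorem *)

Definition width_factor (c : nat) :=
  4 * (3 * (2 ^ c.+2 * (3 + 2 * 2 ^ c.+2)) * c + 1).

(** Uses [k.*2.+1 <= 3 * k] and [k.+1 <= 2 * k], which give the 3 and, with the 2 of [part_width],
    the 4 in [width_factor]. *)
Lemma part_width_quadratic c k : 0 < k -> part_width c k <= width_factor c * (k * k).
Proof.
rewrite /part_width /hitting_number /width_factor; move: (_ * (3 + _)) => K; nia.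
Qed.

Delimit Scope R_scope with R.

Theorem theorem5p4 (t : nat) (ht : 2 <= t) :
  underlying_tw_eq (Kt_minor_free t) (t - 2) /\
  exists Ct : R, forall G : graph, Kt_minor_free t G ->
    forall k : nat, has_tw G k -> 2 <= k ->
      exists w : nat, tpw_le (t - 2) G w /\
        (INR w <= Ct * (INR k ^ 2) * ln (INR k))%R.
Proof.
set c := t - 2; have tE : t = c.+2 by rewrite /c; lia.
have upper (G : graph) k : Kt_minor_free t G -> has_tw G k ->
    tpw_le c G (part_width c k).
  rewrite tE => free [/tw_le_elim[rk [B eB]] _].
  exact: tpw_le_part_width eB free.
split.
  split; last by move=> c'; exact: Kt_minor_free_tpw_unbounded.
  by exists (part_width c) => G free k; exact: upper.
(* As ln k >= ln 2 > 1/2, the factor 2 ln k is at least 1, and the quadratic bound suffices. *)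
exists (2 * INR (width_factor c))%R => G free k kP k2.
exists (part_width c k); split; first exact: upper.
have := part_width_quadratic c (ltnW k2).
move: (width_factor c) => W /leP/le_INR.
rewrite -!multE !mult_INR => le.
have two_le : (2 <= INR k)%R by have /leP/le_INR := k2.
have ln2 : (/ 2 < ln (INR k))%R.
  apply: Rlt_le_trans ln_lt_2 _; case: two_le => [lt|<-]; last exact: Rle_refl.
  by apply/Rlt_le/ln_increasing => //; lra.
have k0 := pos_INR k; have w0 := pos_INR (W).
have pos : (0 <= INR (W) * (INR k * INR k))%R.
  by apply: Rmult_le_pos => //; exact: Rmult_le_pos.
apply: Rle_trans le _.
set X := (_ * (_ * _))%R in pos *; set l := ln _ in ln2 *.
have -> : (2 * INR (W) * INR k ^ 2 * l = X * (2 * l))%R.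
  by rewrite /X; ring.
rewrite -{1}[X]Rmult_1_r; apply: Rmult_le_compat_l => //; lra.
Qed.
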